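(* Every continuous planar curve has an infinite linkage realisation. That is, for every continuous function $\gamma:[0,1]\to\mathbb{R}^2$ there exists an infinite plane linkage $(G,p)$ (not required to be locally finite), with articulating flex $p(t)=(p_1(t),p_2(t),\dots)$, $t\in[0,1]$, and a distinguished vertex $v_m$ of $G$, such that $p_m(t)=\gamma(t)$ for all $t\in[0,1]$.
   Context: A (bar-joint) framework in $\mathbb{R}^2$ is a pair $(G,p)$ where $G=(V,E)$ is a graph with countable vertex set $V=\{v_1,v_2,\dots\}$ and $p=(p_1,p_2,\dots)$ with $p_i\in\mathbb{R}^2$ the position of $v_i$. It is infinite if $V$ is countably infinite, connected if $G$ is connected, and locally finite if each vertex has finite degree. Continuous flex of a framework $(G,p)$: a function $t\mapsto p(t)=(p_1(t),p_2(t),\dots)$ from $[0,1]$ to $\prod_V\mathbb{R}^2$ such that (i) $p(0)=p$; (ii) each $p_i(t)$ is continuous; (iii) for some base edge $(v_a,v_b)$ with $|p_a-p_b|\neq0$, $p_a(t)=p_a(0)$ and $p_b(t)=p_b(0)$ for all $t$; (iv) $|p_i(t)-p_j(t)|=|p_i(0)-p_j(0)|$ for all edges $(v_i,v_j)$ and all $t$; (v) $p(t)$ is not a constant function. Infinite plane linkage: an infinite connected framework $(G,p)$ in $\mathbb{R}^2$ with a degree two vertex $v_1$ with edges $(v_1,v_2),(v_1,v_3)$ and a continuous flex $p(t)$ (the articulating flex) such that (i) the cosine angle function $g(t)=\langle p_2(t)-p_1(t),\,p_3(t)-p_1(t)\rangle$ is strictly increasing on $[0,1]$ (where $\langle\cdot,\cdot\rangle$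 is the usual inner product), and (ii) $p(t)$ is the unique flex $q(t)$ of $(G,p)$ with $q_i(t)=p_i(t)$ for $i=1,2,3$ and all $t$. Linkages are partially normalised so that $p_1(t)=(0,0)$ for all $t$. A continuous planar curve (with parametrisation) is a continuous function from $[0,1]$ to $\mathbb{R}^2$. *)

(* Defs.v *)
From HB Require Import structures.
From mathcomp Require Import all_boot all_order all_algebra.
From mathcomp Require Import all_classical all_reals all_analysis.

Set Implicit Arguments.
Unset Strict Implicit.
Unset Printing Implicit Defensive.

Import Order.TTheory GRing.Theory Num.Theory.
Import numFieldNormedType.Exports.

Local Open Scope classical_set_scope.
Local Open Scope ring_scope.

(* The library norm [`|u|] on ['rV[R]_2] is the sup norm, hence the explicit
   Euclidean inner product and norm; the library topology is the usual one. *)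
Definition dotp (R : realType) (u v : 'rV[R]_2) : R := (u *m v^T) 0 0.

Definition enorm (R : realType) (u : 'rV[R]_2) : R := Num.sqrt (dotp u u).

(* Frameworks in the plane, on a simple graph.  Distinct vertices, even
   adjacent ones, may have the same position. *)
Record framework (R : realType) := Framework {
  vertex : countType;
  edge : rel vertex;
  edge_sym : symmetric edge;
  edge_irr : irreflexive edge;
  pos : vertex -> 'rV[R]_2
}.

Definition infinite_framework (R : realType) (F : framework R) : Prop :=
  infinite_set [set: vertex F].

Definition connected_framework (R : realType) (F : framework R) : Prop :=
  forall x y : vertex F, exists s : seq (vertex F),
    path (@edge R F) x s /\ last x s = y.

Definition degree_two (R : realType) (F : framework R)
    (v1 v2 v3 : vertex F) : Prop :=
  v2 <> v3 /\ forall w : vertex F, edge v1 w <-> (w = v2 \/ w = v3).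

(* A family of motions [p] is a map on the whole of [R] of which only the
   restriction to [0, 1] is meaningful. *)
Record continuous_flex (R : realType) (F : framework R)
    (p : R -> vertex F -> 'rV[R]_2) : Prop := ContinuousFlex {
  flex_start : forall i, p 0 i = pos i;
  flex_continuous : forall i, {within `[0, 1], continuous (fun t => p t i)};
  flex_base : exists a b : vertex F,
    [/\ edge a b, enorm (pos a - pos b) != 0 &
        forall t, t \in `[0, 1] -> p t a = p 0 a /\ p t b = p 0 b];
  flex_edge : forall i j : vertex F, edge i j ->
    forall t, t \in `[0, 1] -> enorm (p t i - p t j) = enorm (p 0 i - p 0 j);
  flex_nonconstant : exists s t : R,
    [/\ s \in `[0, 1], t \in `[0, 1] & p s <> p t]
}.

(* The flexes [q] in [linkage_unique] may have any base edge, not necessarily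
   one fixed by [p]. *)
Record infinite_linkage (R : realType) (F : framework R)
    (v1 v2 v3 : vertex F) (p : R -> vertex F -> 'rV[R]_2) : Prop :=
  InfiniteLinkage {
  linkage_infinite : infinite_framework F;
  linkage_connected : connected_framework F;
  linkage_degree_two : degree_two v1 v2 v3;
  linkage_flex : continuous_flex p;
  linkage_cosine : {in `[0, 1] &, {homo
    (fun t => dotp (p t v2 - p t v1) (p t v3 - p t v1)) : s t / s < t}};
  linkage_unique : forall q : R -> vertex F -> 'rV[R]_2,
    continuous_flex q ->
    (forall t, t \in `[0, 1] ->
       [/\ q t v1 = p t v1, q t v2 = p t v2 & q t v3 = p t v3]) ->
    forall t, t \in `[0, 1] -> forall i, q t i = p t i;
  linkage_normalised : forall t, t \in `[0, 1] -> p t v1 = 0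
}.

(* Main.v *)
Require Import Defs.
From mathcomp Require Import all_boot all_order all_algebra.
From mathcomp Require Import all_classical all_reals all_analysis.
From mathcomp Require Import ring lra.
Set Implicit Arguments.
Unset Strict Implicit.
Unset Printing Implicit Defensive.
Import Order.TTheory GRing.Theory Num.Theory.
Import numFieldNormedType.Exports.
Local Open Scope classical_set_scope.
Local Open Scope ring_scope.

(** Call a motion, that is a map from the line to the plane, realisable when it
belongs to a countable set of motions that is rigidly determined by a crank: if
the pairs at constant distance are joined by bars, then every continuous
deformation that starts at the given position, respects the bars and moves the
crank as prescribed, is the given one.  The crank consists of the fixed point
[(1, 0)] and of a point [v] moving on the unit circle about the origin, with
abscissa [t / 2] at time [t].  A linkage drawing [gamma] is obtained from an
assembly containing [gamma] by adding a hinge at the origin, adjacent to the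
two crank points only; so it suffices to show that every continuous motion is
realisable.  Polynomial curves and the classical linkages that multiply angles
can be avoided, because the limits that an infinite linkage can perform already
give a closed vector space of motions with enough nonlinearity.

- Two determined points determine any third point at constant distance from
  both, as long as the three are never collinear ([realisable_dyad]): the
  other intersection of the two circles is the mirror image, and a continuous
  choice cannot jump.  This gives isosceles apexes, parallelograms and the
  pantograph, which moves a point along the line through two points that never
  meet ([realisable_pantograph]).  Shifting by far away constants removes the
  condition that points never meet, so realisable motions form a vector space
  containing the constants ([realisableD], [realisableZ]).
- A motion [c] that is a uniform limit of realisable ones is realisable
  ([realisable_limit]): link [c] to each of infinitely many approximants by two
  short equal bars.  The lengths tend to zero, which pins [c] down, and shifting
  the approximants slightly keeps them from meeting [c], which pins the elbows.
- The apex of an isosceles triangle with longer and longer legs over the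
  segment from [0] to [f] shows, after rescaling, that the unit normal to [f] is
  realisable ([realisable_normal]).  Its derivative at a constant unit vector [w]
  is, up to sign, the projection of [f] onto the normal of [w], turned along [w],
  so projections are realisable as well ([realisable_projection]).
- Hence the functions [h] with [(h, 0)] realisable form a closed vector space,
  containing the constants and the clamped time [t], and closed under
  [h |-> h / sqrt (h ^ 2 + d ^ 2)], which comes from the unit normal to [(h, d)].
  For small [d] these are smoothed sign functions; step functions in [t] are dense,
  so the space contains every continuous function of the clamped time
  ([step_dense], [axial_comp_clamp]).

Motions are parametrised by the whole line, and the time [t] of the unit interval
enters through the projection [clamp] onto it, so that no domain has to be
carried along. *)


(** * Plane geometry and continuity *)

Section Plane.
Variable R : realType.
Implicit Types (u v w a b c q : 'rV[R]_2) (x y : R).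

Definition vec x y : 'rV[R]_2 := \row_(j < 2) (if j == 0 then x else y).

Definition cross u v : R := u 0 0 * v 0 1 - u 0 1 * v 0 0.

Definition perp u : 'rV[R]_2 := vec (- u 0 1) (u 0 0).

Lemma vec0 x y : vec x y 0 0 = x. Proof. by rewrite mxE. Qed.

Lemma vec1 x y : vec x y 0 1 = y. Proof. by rewrite mxE. Qed.

Lemma dotpE u v : dotp u v = u 0 0 * v 0 0 + u 0 1 * v 0 1.
Proof.
rewrite /dotp mxE !big_ord_recl big_ord0 addr0 !mxE.
by have -> : lift ord0 ord0 = 1 :> 'I_2 by apply/val_inj.
Qed.

Lemma vec_eq u v : u 0 0 = v 0 0 -> u 0 1 = v 0 1 -> u = v.
Proof.
move=> h0 h1; apply/rowP => -[[|[|//]] i].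
- by rewrite (_ : Ordinal i = 0) //; apply/val_inj.
- by rewrite (_ : Ordinal i = 1) //; apply/val_inj.
Qed.

Lemma dotp_ge0 u : 0 <= dotp u u.
Proof. by rewrite dotpE -!expr2 addr_ge0 ?sqr_ge0. Qed.

Lemma dotp_gt0 u : u != 0 -> 0 < dotp u u.
Proof.
move=> u0; rewrite lt_neqAle dotp_ge0 andbT eq_sym.
apply: contra u0; rewrite dotpE -!expr2 paddr_eq0 ?sqr_ge0 // !sqrf_eq0.
by move=> /andP[/eqP h0 /eqP h1]; apply/eqP/vec_eq; rewrite !mxE.
Qed.

Lemma enorm_eqE u v : (enorm u = enorm v) <-> (dotp u u = dotp v v).
Proof.
split => [/(congr1 (fun z => z ^+ 2))|]; last by rewrite /enorm => ->.
by rewrite !sqr_sqrtr ?dotp_ge0.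
Qed.

(** The dot products of [q - a] and [c - a] with [b - a] agree, being determined
by the two distances; Lagrange's identity then fixes the cross product up to
sign. *)
Lemma circles_cross a b c q :
  dotp (q - a) (q - a) = dotp (c - a) (c - a) ->
  dotp (q - b) (q - b) = dotp (c - b) (c - b) ->
  cross (b - a) (q - a) ^+ 2 = cross (b - a) (c - a) ^+ 2.
Proof.
rewrite /cross !dotpE !mxE.
move: (a 0 0) (a 0 1) (b 0 0) (b 0 1) (c 0 0) (c 0 1) (q 0 0) (q 0 1).
move=> a0 a1 b0 b1 c0 c1 q0 q1 ha hb.
have hd : (b0 - a0) * (q0 - a0) + (b1 - a1) * (q1 - a1)
   = (b0 - a0) * (c0 - a0) + (b1 - a1) * (c1 - a1) by lra.
have L (s t s' t' : R) : (s * t' - t * s') ^+ 2 =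
   (s * s + t * t) * (s' * s' + t' * t') - (s * s' + t * t') ^+ 2 by ring.
by rewrite !L ha hd.
Qed.

Lemma circles_eq a b c q :
  dotp (q - a) (q - a) = dotp (c - a) (c - a) ->
  dotp (q - b) (q - b) = dotp (c - b) (c - b) ->
  cross (b - a) (q - a) = cross (b - a) (c - a) ->
  cross (b - a) (c - a) != 0 -> q = c.
Proof.
move=> ha hb hc c0.
have : b - a != 0.
  by apply: contraNneq c0 => ->; rewrite /cross !mxE; apply/eqP; ring.
move=> /dotp_gt0; move: ha hb hc; rewrite /cross !dotpE !mxE => ha hb hc d0.
have hd : (b 0 0 - a 0 0) * (q 0 0 - c 0 0) + (b 0 1 - a 0 1) * (q 0 1 - c 0 1) = 0 by lra.
have hc' : (b 0 0 - a 0 0) * (q 0 1 - c 0 1) - (b 0 1 - a 0 1) * (q 0 0 - c 0 0) = 0 by lra.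
have cancel x y : ((b 0 0 - a 0 0) * (b 0 0 - a 0 0) +
    (b 0 1 - a 0 1) * (b 0 1 - a 0 1)) * (x - y) = 0 -> x = y.
  by move/eqP; rewrite mulf_eq0 gt_eqF //= subr_eq0 => /eqP.
apply: vec_eq; apply: cancel.
- transitivity ((b 0 0 - a 0 0) * ((b 0 0 - a 0 0) * (q 0 0 - c 0 0) + (b 0 1 - a 0 1) * (q 0 1 - c 0 1))
   - (b 0 1 - a 0 1) * ((b 0 0 - a 0 0) * (q 0 1 - c 0 1) - (b 0 1 - a 0 1) * (q 0 0 - c 0 0))); first by ring.
  by rewrite hd hc' !mulr0 subr0.
- transitivity ((b 0 1 - a 0 1) * ((b 0 0 - a 0 0) * (q 0 0 - c 0 0) + (b 0 1 - a 0 1) * (q 0 1 - c 0 1))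
   + (b 0 0 - a 0 0) * ((b 0 0 - a 0 0) * (q 0 1 - c 0 1) - (b 0 1 - a 0 1) * (q 0 0 - c 0 0))); first by ring.
  by rewrite hd hc' !mulr0 addr0.
Qed.

Lemma coord0_continuous (f : R -> 'rV[R]_2) :
  continuous f -> continuous (fun t => f t 0 0).
Proof.
move=> cf t; apply: (@continuous_comp _ _ _ f (fun u : 'rV[R]_2 => u 0 0)).
  exact: cf.
exact: coord_continuous.
Qed.

Lemma coord1_continuous (f : R -> 'rV[R]_2) :
  continuous f -> continuous (fun t => f t 0 1).
Proof.
move=> cf t; apply: (@continuous_comp _ _ _ f (fun u : 'rV[R]_2 => u 0 1)).
  exact: cf.
exact: coord_continuous.
Qed.

Lemma vec_continuous (f g : R -> R) :
  continuous f -> continuous g -> continuous (fun t => vec (f t) (g t)).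
Proof.
move=> cf cg t.
have -> : (fun t => vec (f t) (g t)) = (fun t => f t *: vec 1 0 + g t *: vec 0 1).
  by apply/funext => s; apply: vec_eq; rewrite !mxE /= ?mulr0 ?mulr1 ?addr0 ?add0r.
apply: (@continuousD _ _ _ (fun t => f t *: vec 1 0) (fun t => g t *: vec 0 1)).
  by apply: continuousZr_tmp; apply: cf.
by apply: continuousZr_tmp; apply: cg.
Qed.

(** The quotient of the two functions is continuous with values [1] and [-1], so
it keeps its value at [0]. *)
Lemma eq_of_sqr_eq (f g : R -> R) : continuous f -> continuous g ->
  (forall t, f t ^+ 2 = g t ^+ 2) -> (forall t, g t != 0) -> f 0 = g 0 ->
  f = g.
Proof.
move=> cf cg sq g0 fg0; apply/funext => t.
pose h := fun s => f s / g s.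
have ch : continuous h.
  by move=> s; apply: (@continuousM _ _ f (fun s => (g s)^-1)); [exact: cf|apply: continuousV; [exact: g0|exact: cg]].
have h2 s : h s ^+ 2 = 1.
  by rewrite /h exprMn sq -exprMn divff ?expr1n.
have h00 : h 0 = 1 by rewrite /h fg0 divff.
suff ht : h t = 1 by have := ht; rewrite /h => /(canRL (divfK (g0 t))); rewrite mul1r.
move: (h2 t) => /eqP; rewrite sqrf_eq1 => /orP[/eqP //|/eqP ht].
have hne s : h s != 0.
  by apply/eqP => hs; have := h2 s; rewrite hs expr0n => /eqP; rewrite eq_sym oner_eq0.
have [le|/ltW le] := leP 0 t.
  have [s _ hs] : exists2 s, s \in `[0, t] & h s = 0.
    apply: IVT => //; first by apply: continuous_subspaceT.
    by rewrite h00 ht ge_min le_max lerN10 ler01 orbT.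
  by have := hne s; rewrite hs eqxx.
have [s _ hs] : exists2 s, s \in `[t, 0] & h s = 0.
  apply: IVT => //; first by apply: continuous_subspaceT.
  by rewrite h00 ht ge_min le_max lerN10 ler01 orbT.
by have := hne s; rewrite hs eqxx.
Qed.

End Plane.

(** * Rigidly determined assemblies of motions *)

Notation motion R := (R -> 'rV[R]_2).

Section Assemblies.
Variable R : realType.
Implicit Types (f g a b c : motion R) (S T : set (motion R)) (q : motion R -> motion R).

(** The two motions can be joined by a bar.  The distance is squared to keep the
algebra polynomial. *)
Definition rigid f g : Prop :=
  forall t, dotp (f t - g t) (f t - g t) = dotp (f 0 - g 0) (f 0 - g 0).

Lemma dotpBC (u v : 'rV[R]_2) : dotp (u - v) (u - v) = dotp (v - u) (v - u).
Proof. by rewrite !dotpE !mxE; ring. Qed.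

Lemma rigidC f g : rigid f g -> rigid g f.
Proof. by move=> h t; rewrite dotpBC h dotpBC. Qed.

(** [q] moves each member of [S] by a motion of its own, as a competing flex of
the bar framework on [S] does. *)
Record deformation S q : Prop := Deformation {
  deformation_continuous : forall f, S f -> continuous (q f);
  deformation_start : forall f, S f -> q f 0 = f 0;
  deformation_bar : forall f g, S f -> S g -> rigid f g -> rigid (q f) (q g)
}.

Lemma deformation_sub S T q : S `<=` T -> deformation T q -> deformation S q.
Proof.
move=> ST [qc q0 qb]; split; [by move=> f /ST /qc|by move=> f /ST /q0|].
by move=> f g /ST Sf /ST Sg; apply: qb.
Qed.

Lemma deformation_dist S q f g t : deformation S q -> S f -> S g ->
  rigid f g -> dotp (q f t - q g t) (q f t - q g t) = dotp (f t - g t) (f t - g t).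
Proof.
move=> [_ q0 qb] Sf Sg fg.
by rewrite (qb f g Sf Sg fg t) !q0 // (fg t).
Qed.

Variable B : set (motion R).

(** Connectedness to [B] is phrased as an induction principle, so that it passes to
unions; it serves both for the connectedness of the final graph and for the
boundedness of realisable motions. *)
Record assembly S : Prop := Assembly {
  assembly_countable : countable S;
  assembly_continuous : forall f, S f -> continuous f;
  assembly_base : B `<=` S;
  assembly_determined : forall q, deformation S q ->
    (forall f, B f -> q f = f) -> forall f, S f -> q f = f;
  assembly_connected : forall A : set (motion R), B `<=` A ->
    (forall f g, S f -> S g -> A f -> rigid f g -> A g) -> S `<=` A
}.

Definition realisable f : Prop := exists2 S, assembly S & S f.

(** Assemblies can be put side by side, sharing the motions they have in common,
since each of them is determined by the same [B]. *)
Lemma assembly_bigcup (S : nat -> set (motion R)) :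
  (forall n, assembly (S n)) -> assembly (\bigcup_n S n).
Proof.
move=> aS; split.
- by apply: bigcup_countable => // n _; apply: assembly_countable (aS n).
- by move=> f [n _ Snf]; exact: (assembly_continuous (aS n) Snf).
- by move=> f Bf; exists 0%N => //; exact: (assembly_base (aS 0%N) Bf).
- move=> q dq qB f [n _ Snf]; apply: (assembly_determined (aS n)) => //.
  by apply: deformation_sub dq; apply: bigcup_sup.
- move=> A BA bar f [n _ Snf]; apply: (assembly_connected (aS n) BA) Snf.
  by move=> g h Sg Sh; apply: bar; exists n.
Qed.

Lemma assembly_extend S T : assembly S -> countable T ->
  (forall f, T f -> continuous f) ->
  (forall q, deformation (S `|` T) q -> (forall f, S f -> q f = f) ->
     forall f, T f -> q f = f) ->
  (forall A : set (motion R), S `<=` A ->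
     (forall f g, (S `|` T) f -> (S `|` T) g -> A f -> rigid f g -> A g) ->
     T `<=` A) ->
  assembly (S `|` T).
Proof.
move=> aS cT cntT detT conT; split.
- rewrite -bigcup2E; apply: bigcup_countable => // -[|[|n]] _ //=.
  exact: assembly_countable aS.
- by move=> f [Sf|/cntT //]; exact: (assembly_continuous aS Sf).
- by move=> f Bf; left; exact: (assembly_base aS Bf).
- move=> q dq qB.
  have qS : forall f, S f -> q f = f.
    apply: (assembly_determined aS) => //.
    by apply: deformation_sub dq; apply: subsetUl.
  by move=> f [/qS //|]; apply: detT.
- move=> A BA bar.
  have SA : S `<=` A.
    apply: (assembly_connected aS BA).
    by move=> f g Sf Sg; apply: bar; left.
  by move=> f [/SA //|]; apply: conT.
Qed.

Lemma realisable_family (x : nat -> motion R) : (forall n, realisable (x n)) ->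
  exists2 S, assembly S & forall n, S (x n).
Proof.
move=> rx.
have /choice[S SP] : forall n, exists S, assembly S /\ S (x n).
  by move=> n; have [S aS Sx] := rx n; exists S.
exists (\bigcup_n S n).
- by apply: assembly_bigcup => n; case: (SP n).
- by move=> n; exists n => //; case: (SP n).
Qed.

Lemma realisable_pair f g : realisable f -> realisable g ->
  exists S, [/\ assembly S, S f & S g].
Proof.
move=> rf rg.
have [|S aS Sx] := @realisable_family (fun n => if n is 0%N then f else g).
  by case.
by exists S; split => //; [apply: (Sx 0%N)|apply: (Sx 1%N)].
Qed.

Lemma realisable_continuous f : realisable f -> continuous f.
Proof. by move=> [S aS]; apply: assembly_continuous. Qed.

Lemma cross_continuous a b c : continuous a -> continuous b -> continuous c ->
  continuous (fun t => cross (b t - a t) (c t - a t)).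
Proof.
move=> ca cb cc.
have -> : (fun t => cross (b t - a t) (c t - a t)) = (fun t =>
  (b t 0 0 - a t 0 0) * (c t 0 1 - a t 0 1) - (b t 0 1 - a t 0 1) * (c t 0 0 - a t 0 0)).
  by apply/funext => t; rewrite /cross !mxE.
by move=> t; apply: cvgB; apply: cvgM; apply: cvgB;
  (apply: coord0_continuous || apply: coord1_continuous).
Qed.

(** The cross product of [b - a] and [q c - a] cannot vanish, so its sign, which
tells the two intersections of the circles apart, is that of the initial
position. *)
Lemma determined_dyad S q a b c : deformation S q -> S a -> S b -> S c ->
  continuous a -> continuous b -> continuous c ->
  q a = a -> q b = b -> rigid c a -> rigid c b ->
  (forall t, cross (b t - a t) (c t - a t) != 0) -> q c = c.
Proof.
move=> dq Sa Sb Sc ca cb cc qa qb rca rcb c0.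
have da t : dotp (q c t - a t) (q c t - a t) = dotp (c t - a t) (c t - a t).
  by rewrite -{1 2}qa (deformation_dist _ dq).
have db t : dotp (q c t - b t) (q c t - b t) = dotp (c t - b t) (c t - b t).
  by rewrite -{1 2}qb (deformation_dist _ dq).
have /(congr1 (fun h => h _)) eqc : (fun t => cross (b t - a t) (q c t - a t))
   = (fun t => cross (b t - a t) (c t - a t)).
  apply: eq_of_sqr_eq => //.
  - by apply: cross_continuous => //; exact: (deformation_continuous dq Sc).
  - exact: cross_continuous.
  - by move=> t; apply: circles_cross.
  - by rewrite (deformation_start dq).
by apply/funext => t; apply: circles_eq (da t) (db t) (eqc t) (c0 t).
Qed.

Lemma realisable_dyad a b c : realisable a -> realisable b -> continuous c ->
  rigid c a -> rigid c b ->
  (forall t, cross (b t - a t) (c t - a t) != 0) -> realisable c.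
Proof.
move=> ra rb cc rca rcb c0.
have [S [aS Sa Sb]] := realisable_pair ra rb.
exists (S `|` [set c]); last by right.
apply: assembly_extend => //.
- by move=> f ->.
- move=> q dq qS f ->.
  apply: (determined_dyad dq _ _ _ _ _ cc (qS _ Sa) (qS _ Sb)) => //.
  + by left.
  + by left.
  + by right.
  + exact: realisable_continuous.
  + exact: realisable_continuous.
- move=> A SA bar f ->; apply: (bar a); [by left|by right|exact: SA|exact: rigidC].
Qed.

(** The third vertex of the isosceles triangle with base [u v] and legs [r], on
the left of the base. *)
Definition apex (r : R) (u v : 'rV[R]_2) : 'rV[R]_2 :=
  u + 2^-1 *: (v - u) +
  Num.sqrt (r ^+ 2 / dotp (v - u) (v - u) - 4^-1) *: perp (v - u).

Lemma apexP (r : R) (u v : 'rV[R]_2) : u != v ->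
    dotp (v - u) (v - u) < 4 * r ^+ 2 ->
  [/\ dotp (apex r u v - u) (apex r u v - u) = r ^+ 2,
      dotp (apex r u v - v) (apex r u v - v) = r ^+ 2 &
      cross (v - u) (apex r u v - u) != 0].
Proof.
move=> uv lt4.
have d0 : 0 < dotp (v - u) (v - u) by rewrite dotp_gt0 // subr_eq0 eq_sym.
rewrite /apex; set d := dotp _ _ in lt4 d0 *.
have k0 : 0 < r ^+ 2 / d - 4^-1.
  by rewrite subr_gt0 ltr_pdivlMr // ltr_pdivrMl.
have kk : Num.sqrt (r ^+ 2 / d - 4^-1) ^+ 2 * d = r ^+ 2 - 4^-1 * d.
  by rewrite sqr_sqrtr ?ltW // mulrBl divfK ?gt_eqF.
have kp : Num.sqrt (r ^+ 2 / d - 4^-1) * d != 0.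
  by rewrite gt_eqF // mulr_gt0 // sqrtr_gt0.
move: (Num.sqrt _) kk kp => k; rewrite /d !dotpE /cross /perp !mxE /= => kk kp.
split.
- by rewrite -[RHS](subrK (4^-1 * ((v 0 0 - u 0 0) * (v 0 0 - u 0 0) +
    (v 0 1 - u 0 1) * (v 0 1 - u 0 1)))) -kk; field.
- by rewrite -[RHS](subrK (4^-1 * ((v 0 0 - u 0 0) * (v 0 0 - u 0 0) +
    (v 0 1 - u 0 1) * (v 0 1 - u 0 1)))) -kk; field.
- by apply: contra_neq kp => <-; field.
Qed.

Lemma perp_continuous f : continuous f -> continuous (fun t => perp (f t)).
Proof.
move=> cf; apply: vec_continuous; last exact: coord0_continuous.
by move=> t; apply: cvgN; apply: coord1_continuous.
Qed.

Lemma dotp_continuous f : continuous f -> continuous (fun t => dotp (f t) (f t)).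
Proof.
move=> cf.
have -> : (fun t => dotp (f t) (f t)) = (fun t => f t 0 0 * f t 0 0 + f t 0 1 * f t 0 1).
  by apply/funext => t; rewrite dotpE.
by move=> t; apply: cvgD; apply: cvgM;
  (apply: coord0_continuous || apply: coord1_continuous).
Qed.

Lemma motionB_continuous f g : continuous f -> continuous g ->
  continuous (fun t => f t - g t).
Proof. by move=> cf cg t; apply: cvgB; [exact: cf|exact: cg]. Qed.

Lemma motionD_continuous f g : continuous f -> continuous g ->
  continuous (fun t => f t + g t).
Proof. by move=> cf cg t; apply: cvgD; [exact: cf|exact: cg]. Qed.

Lemma motionZ_continuous (k : R) f : continuous f -> continuous (fun t => k *: f t).
Proof. by move=> cf t; apply: cvgZl_tmp; exact: cf. Qed.

Lemma sqrt_comp_continuous (h : R -> R) :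
  continuous h -> continuous (fun t => Num.sqrt (h t)).
Proof.
move=> ch t; apply: (@continuous_comp _ _ _ h (@Num.sqrt R)); first exact: ch.
exact: sqrt_continuous.
Qed.

Lemma apex_continuous (r : R) f g : continuous f -> continuous g ->
  (forall t, f t != g t) -> continuous (fun t => apex r (f t) (g t)).
Proof.
move=> cf cg fg.
have cd : continuous (fun t => g t - f t) by exact: motionB_continuous.
apply: (@motionD_continuous (fun t => f t + 2^-1 *: (g t - f t))).
  by apply: motionD_continuous; [exact: cf|exact: motionZ_continuous].
move=> t; apply: cvgZ; last exact: perp_continuous.
pose h t := r ^+ 2 / dotp (g t - f t) (g t - f t) - 4^-1.
apply: (@sqrt_comp_continuous h) => {}t.
apply: cvgB; last exact: cvg_cst.
apply: cvgM; first exact: cvg_cst.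
apply: cvgV; last exact: (dotp_continuous cd).
by rewrite gt_eqF // dotp_gt0 // subr_eq0 eq_sym.
Qed.

Lemma realisable_apex (r : R) f g : realisable f -> realisable g ->
  (forall t, f t != g t) ->
  (forall t, dotp (g t - f t) (g t - f t) < 4 * r ^+ 2) ->
  realisable (fun t => apex r (f t) (g t)).
Proof.
move=> rf rg fg lt4; apply: (@realisable_dyad f g) => //.
- by apply: apex_continuous => //; apply: realisable_continuous.
- move=> t; have [-> _ _] := apexP (r := r) (fg t) (lt4 t).
  by have [-> _ _] := apexP (r := r) (fg 0) (lt4 0).
- move=> t; have [_ -> _] := apexP (r := r) (fg t) (lt4 t).
  by have [_ -> _] := apexP (r := r) (fg 0) (lt4 0).
- by move=> t; have [_ _] := apexP (r := r) (fg t) (lt4 t).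
Qed.

Lemma dotpD_le (u v : 'rV[R]_2) : dotp (u + v) (u + v) <= 2 * (dotp u u + dotp v v).
Proof.
rewrite !dotpE !mxE -subr_ge0.
have -> : 2 * (u 0 0 * u 0 0 + u 0 1 * u 0 1 + (v 0 0 * v 0 0 + v 0 1 * v 0 1)) -
  ((u 0 0 + v 0 0) * (u 0 0 + v 0 0) + (u 0 1 + v 0 1) * (u 0 1 + v 0 1)) =
  (u 0 0 - v 0 0) ^+ 2 + (u 0 1 - v 0 1) ^+ 2 by ring.
by rewrite addr_ge0 ?sqr_ge0.
Qed.

(** An infinite linkage performing a limit: [c] is joined to every [x n] by two
bars of length [r n] meeting at an elbow.  In a deformation the end stays within
[2 * r n] of [x n] for all [n], so it has to be [c]; each elbow is then
determined as the apex of a nondegenerate triangle. *)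
Lemma realisable_limit_strict (x : nat -> motion R) (r : nat -> R) c :
  (forall n, realisable (x n)) -> continuous c ->
  (forall e, 0 < e -> exists n, r n ^+ 2 < e) ->
  (forall n t, x n t != c t) ->
  (forall n t, dotp (c t - x n t) (c t - x n t) < 4 * r n ^+ 2) ->
  realisable c.
Proof.
move=> rx cc r0 xc lt4.
have [S aS Sx] := realisable_family rx.
pose a n t := apex (r n) (x n t) (c t).
have ax n t : dotp (a n t - x n t) (a n t - x n t) = r n ^+ 2.
  by have [] := apexP (r := r n) (xc n t) (lt4 n t).
have ac n t : dotp (a n t - c t) (a n t - c t) = r n ^+ 2.
  by have [] := apexP (r := r n) (xc n t) (lt4 n t).
have ca n : continuous (a n).
  by apply: apex_continuous => //; apply: realisable_continuous.
have rax n : rigid (a n) (x n) by move=> t; rewrite !ax.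
have rac n : rigid (a n) c by move=> t; rewrite !ac.
exists (S `|` (c |` range a)); last by right; left.
have Sc : (S `|` (c |` range a)) c by right; left.
have Sa n : (S `|` (c |` range a)) (a n) by right; right; exists n.
have Sx' n : (S `|` (c |` range a)) (x n) by left.
apply: assembly_extend => //.
- rewrite -bigcup2E; apply: bigcup_countable => // -[|[|n]] _ //=.
  exact: card_image_le.
- by move=> f [->//|[n _ <-]].
- move=> q dq qS.
  (* otherwise choose [n] with [16 * r n ^ 2] below the squared gap, and compare through [x n] *)
  have qc : q c = c.
    apply/funext => t; apply/eqP; rewrite -subr_eq0; apply/negPn/negP => /dotp_gt0 lt0.
    have [n] := r0 (dotp (q c t - c t) (q c t - c t) / 16) (divr_gt0 lt0 (ltr0n _ 16)).
    apply/negP; rewrite -leNgt ler_pdivrMr //.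
    have b1 : dotp (q c t - x n t) (q c t - x n t) <= 4 * r n ^+ 2.
      rewrite -[q c t - _](subrKA (q (a n) t)); apply: le_trans (dotpD_le _ _) _.
      rewrite (dotpBC (q c t)) -{1 2}(qS (x n)) //.
      rewrite !(deformation_dist _ dq) // ax ac.
      by rewrite le_eqVlt; apply/orP; left; apply/eqP; ring.
    rewrite -[q c t - _](subrKA (x n t)); apply: le_trans (dotpD_le _ _) _.
    rewrite (dotpBC (x n t)).
    have := lt4 n t; lra.
  move=> f [->//|[n _ <-]].
  apply: (determined_dyad dq (Sx' n) Sc (Sa n)) => //.
  + exact: realisable_continuous.
  + exact: qS.
  + by move=> t; have [] := apexP (r := r n) (xc n t) (lt4 n t).
- move=> A SA bar.
  have Aa n : A (a n) by apply: (bar (x n)); [exact: Sx'|exact: Sa|exact: SA|exact: rigidC].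
  by move=> f [->|[n _ <-]//]; apply: (bar (a 0%N)).
Qed.

End Assemblies.

(** * Bars, parallelograms, pantographs and the vector space they generate *)

Section Mechanisms.
Variable R : realType.
Variable B : set (motion R).
Implicit Types (f g a b c : motion R) (l : R).
Local Notation realisable := (realisable B).

Lemma dotpZ l (u : 'rV[R]_2) : dotp (l *: u) (l *: u) = l ^+ 2 * dotp u u.
Proof. by rewrite !dotpE !mxE; ring. Qed.

Lemma rigid_scale l f g a b : (forall t, f t - g t = l *: (a t - b t)) ->
  rigid a b -> rigid f g.
Proof. by move=> h ab t; rewrite !h !dotpZ ab. Qed.

(** The circles about the two ends of a bar through a point of its line are tangent
there, so a point off the line is attached first. *)
Lemma realisable_extended_bar l f g : realisable f -> realisable g ->
  rigid f g -> f 0 != g 0 -> l != 0 ->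
  realisable (fun t => f t + l *: (g t - f t)).
Proof.
move=> rf rg fg fg0 l0.
have cf := realisable_continuous rf; have cg := realisable_continuous rg.
have cd := motionB_continuous cg cf.
have gf := rigidC fg.
have d0 : dotp (g 0 - f 0) (g 0 - f 0) != 0.
  by rewrite gt_eqF // dotp_gt0 // subr_eq0 eq_sym.
have rz : realisable (fun t => f t + perp (g t - f t)).
  apply: (realisable_dyad rf rg).
  - by apply: motionD_continuous; [exact: cf|exact: perp_continuous].
  - by move=> t; move: (gf t); rewrite !dotpE !mxE /=; lra.
  - by move=> t; move: (gf t); rewrite !dotpE !mxE /=; lra.
  - move=> t; apply: contra_neq d0 => h; rewrite -(gf t) -[RHS]h.
    by rewrite /cross !dotpE !mxE /=; ring.
apply: (realisable_dyad rf rz).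
- by apply: motionD_continuous; [exact: cf|exact: motionZ_continuous].
- by apply: (rigid_scale (l := l) _ gf) => t; rewrite addrC addKr.
- have E t : dotp (f t + l *: (g t - f t) - (f t + perp (g t - f t)))
      (f t + l *: (g t - f t) - (f t + perp (g t - f t))) =
      (1 + l ^+ 2) * dotp (g t - f t) (g t - f t).
    by rewrite !dotpE !mxE /=; ring.
  by move=> t; rewrite !E gf.
- move=> t; apply: contra_neq (mulf_neq0 l0 d0) => h; rewrite -(gf t).
  apply: oppr_inj; rewrite oppr0 -[RHS]h.
  by rewrite /cross !dotpE !mxE /=; ring.
Qed.

Lemma realisable_parallelogram a b c :
  realisable a -> realisable b -> realisable c -> rigid b a -> rigid c a ->
  (forall t, cross (b t - a t) (c t - a t) != 0) ->
  realisable (fun t => b t + c t - a t).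
Proof.
move=> ra rb rc ba ca bc0.
have cta := realisable_continuous ra; have ctb := realisable_continuous rb.
have ctc := realisable_continuous rc.
apply: (realisable_dyad rb rc).
- by apply: motionB_continuous; [exact: motionD_continuous|exact: cta].
- by apply: (rigid_scale (l := 1) _ ca) => t; rewrite scale1r addrC addrA addKr.
- by apply: (rigid_scale (l := 1) _ ba) => t; rewrite scale1r addrAC addrK.
- move=> t; apply: contra_neq (bc0 t) => h; apply: oppr_inj; rewrite oppr0 -[RHS]h.
  by rewrite /cross !mxE; ring.
Qed.

(** The pantograph: with an elbow [x] over [f g], the bar from [f] to [x] is extended
to [n], the parallelogram [x n m g] is completed, and the bar from [n] to [m] is
extended to the required point. *)
Lemma realisable_pantograph_bounded (r : R) l f g :
  realisable f -> realisable g ->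
  (forall t, f t != g t) ->
  (forall t, dotp (g t - f t) (g t - f t) < 4 * r ^+ 2) ->
  l != 0 -> l != 1 -> realisable (fun t => f t + l *: (g t - f t)).
Proof.
move=> rf rg fg lt4 l0 l1.
pose x t := apex r (f t) (g t).
have rx : realisable x by exact: realisable_apex.
have [xf xg x0] : [/\ rigid x f, rigid x g &
    forall t, cross (g t - f t) (x t - f t) != 0].
  split=> t; have [h1 h2 h3] := apexP (fg t) (lt4 t); last exact: h3.
  - by have [h4 _ _] := apexP (fg 0) (lt4 0); rewrite h1.
  - by have [_ h4 _] := apexP (fg 0) (lt4 0); rewrite h2.
have fx0 : f 0 != x 0.
  by apply: contra_neq (x0 0) => <-; rewrite /cross !mxE; ring.
have gx0 : g 0 != x 0.
  by apply: contra_neq (x0 0) => <-; rewrite /cross !mxE; ring.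
pose n t := f t + l *: (x t - f t).
have rn : realisable n by exact: (realisable_extended_bar rf rx (rigidC xf) fx0 l0).
have nx : rigid n x.
  apply: (rigid_scale (l := l - 1) _ xf) => t.
  by apply: vec_eq; rewrite /n !mxE; ring.
pose m t := n t + g t - x t.
have rm : realisable m.
  apply: (realisable_parallelogram rx rn rg nx); first exact: rigidC.
  have l10 : l - 1 != 0 by rewrite subr_eq0.
  move=> t; apply: contra_neq (mulf_neq0 l10 (x0 t)) => h.
  apply: oppr_inj; rewrite oppr0 -[RHS]h.
  by rewrite /cross /n !mxE; ring.
have mn : rigid m n.
  by apply: (rigid_scale (l := -1) _ xg) => t; rewrite /m; apply: vec_eq; rewrite !mxE; ring.
have -> : (fun t => f t + l *: (g t - f t)) = (fun t => n t + l *: (m t - n t)).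
  by apply/funext => t; rewrite /m /n; apply: vec_eq; rewrite !mxE; ring.
apply: (realisable_extended_bar rn rm) l0; first exact: rigidC.
apply: contra_neq gx0 => /(congr1 (fun u => u - n 0 + x 0)).
rewrite subrr add0r => ->; apply: vec_eq; rewrite /m !mxE; ring.
Qed.

End Mechanisms.

Section Closure.
Variables (R : realType) (v : motion R).
Hypothesis v_continuous : continuous v.
Hypothesis v_unit : forall t, dotp (v t) (v t) = 1.
Hypothesis v_offaxis : forall t, v t 0 1 != 0.
Implicit Types (f g a b c : motion R) (l : R).

(** The fixed and the moving neighbour of the hinge at the origin. *)
Definition crank : set (motion R) := [set cst (vec 1 0); v].

Local Notation realisable := (realisable crank).

Lemma realisable_crank f : crank f -> realisable f.
Proof.
move=> Bf; exists crank => //; split => //.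
- rewrite /crank -bigcup2E; apply: bigcup_countable => // -[|[|n]] _ //=; exact: countable1.
- by move=> g [->|->] //; exact: cst_continuous.
Qed.

(** The origin is at distance [1] from both crank points and never collinear with
them. *)
Lemma realisable0 : realisable (cst 0).
Proof.
apply: (@realisable_dyad _ _ (cst (vec 1 0)) v).
- by apply: realisable_crank; left.
- by apply: realisable_crank; right.
- exact: cst_continuous.
- by [].
- by move=> t /=; rewrite !(dotpBC 0) !subr0 !v_unit.
- move=> t /=; apply: contra_neq (v_offaxis t) => <-.
  by rewrite /cross !mxE /=; ring.
Qed.

Lemma realisable_cst (u : 'rV[R]_2) : realisable (cst u).
Proof.
(* a fixed point not aligned with the origin and [w] is a dyad over the two *)
have step (w z : 'rV[R]_2) : realisable (cst w) -> cross w z != 0 -> realisable (cst z).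
  move=> rw wz; apply: (realisable_dyad realisable0 rw) => //.
  - exact: cst_continuous.
  - by move=> t /=; rewrite !subr0.
have r1 : realisable (cst (vec 1 0)) by apply: realisable_crank; left.
have r2 : realisable (cst (vec 0 1)).
  apply: step r1 _; rewrite /cross !mxE /= mulr1 mul0r subr0; exact: oner_neq0.
have [u1|u1] := eqVneq (u 0 1) 0; last first.
  by apply: step r1 _; rewrite /cross !mxE /= mul1r mul0r subr0.
have [u0|u0] := eqVneq (u 0 0) 0; last first.
  by apply: step r2 _; rewrite /cross !mxE /= mul1r mul0r sub0r oppr_eq0.
have -> : u = 0 by apply: vec_eq; rewrite !mxE.
exact: realisable0.
Qed.

(** Bars have constant length and the assembly is connected to the bounded crank. *)
Lemma realisable_bounded f : realisable f -> exists M, forall t, dotp (f t) (f t) <= M.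
Proof.
move=> [S aS Sf].
apply: (assembly_connected aS
  (A := [set g | exists M, forall t, dotp (g t) (g t) <= M]) _ _ Sf).
- move=> g [->|->]; exists 1 => t; last by rewrite v_unit.
  by rewrite /= dotpE !mxE /= mulr0 addr0 mulr1.
- move=> g h _ _ [M gM] gh.
  exists (2 * (M + dotp (h 0 - g 0) (h 0 - g 0))) => t.
  rewrite -[h t](subrK (g t)) addrC; apply: le_trans (dotpD_le _ _) _.
  by rewrite (rigidC gh) ler_pM2l // lerD2r.
Qed.

Lemma realisable_box f : realisable f -> exists2 M, 0 < M &
  forall t, `|f t 0 0| <= M /\ `|f t 0 1| <= M.
Proof.
move=> /realisable_bounded[M fM]; exists (M + 1).
  by apply: lt_le_trans ltr01 _; rewrite lerDr (le_trans _ (fM 0)) // dotp_ge0.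
move=> t; move: (fM t); rewrite dotpE !ler_norml.
move: (f t 0 0) (f t 0 1) => x y; split; apply/andP; split; nra.
Qed.

Lemma realisable_pantograph l f g : realisable f -> realisable g ->
  (forall t, f t != g t) -> l != 0 -> l != 1 ->
  realisable (fun t => f t + l *: (g t - f t)).
Proof.
move=> rf rg fg.
have [M fM] := realisable_bounded rf; have [N gN] := realisable_bounded rg.
have M0 : 0 <= M by apply: le_trans (fM 0); exact: dotp_ge0.
have N0 : 0 <= N by apply: le_trans (gN 0); exact: dotp_ge0.
apply: (@realisable_pantograph_bounded _ _ (M + N + 1)) => // t.
rewrite (le_lt_trans (dotpD_le _ _)) // -scaleN1r dotpZ sqrrN expr1n mul1r.
by move: (fM t) (gN t); nra.
Qed.

(** The sum is the midpoint of [2 * f - k] and [2 * g + k]; for a large constant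
[k] none of the three pantographs involved degenerates. *)
Lemma realisableD f g : realisable f -> realisable g -> realisable (fun t => f t + g t).
Proof.
move=> rf rg.
have [M M0 fM] := realisable_box rf; have [N N0 gN] := realisable_box rg.
have two0 : (2 : R) != 0 by rewrite pnatr_eq0.
have two1 : (2 : R) != 1 by rewrite gt_eqF // ltr1n.
have lt0 (x y : R) : x < y -> x != y by move=> /lt_eqF ->.
pose K := M + N + 1.
(* the box bounds keep [f] away from the point at [K] and [g] from the one at [- K] *)
have r1 : realisable (fun t => vec K 0 + 2 *: (f t - vec K 0)).
  apply: realisable_pantograph => //; first exact: realisable_cst.
  move=> t; apply/negP => /eqP /(congr1 (fun u : 'rV[R]_2 => u 0 0)).
  by rewrite mxE /=; have [] := fM t; rewrite /K !ler_norml => /andP[]; lra.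
have r2 : realisable (fun t => vec (- K) 0 + 2 *: (g t - vec (- K) 0)).
  apply: realisable_pantograph => //; first exact: realisable_cst.
  move=> t; apply/negP => /eqP /(congr1 (fun u : 'rV[R]_2 => u 0 0)).
  by rewrite mxE /=; have [] := gN t; rewrite /K !ler_norml => /andP[]; lra.
have := realisable_pantograph (l := 2^-1) r1 r2 _ _ _.
have -> : (fun t => vec K 0 + 2 *: (f t - vec K 0) + 2^-1 *:
    (vec (- K) 0 + 2 *: (g t - vec (- K) 0) -
    (vec K 0 + 2 *: (f t - vec K 0)))) = (fun t => f t + g t).
  by apply/funext => t; apply: vec_eq; rewrite !mxE /=; field.
apply.
- move=> t; apply/negP => /eqP /(congr1 (fun u : 'rV[R]_2 => u 0 0)).
  rewrite !mxE /=; have [] := fM t; have [] := gN t.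
  by rewrite /K !ler_norml => /andP[? ?] _ /andP[? ?] _; lra.
- by rewrite invr_eq0.
- by apply: contra_neq two1 => h; rewrite -[2]invrK h invr1.
Qed.

Lemma realisableZ l f : realisable f -> realisable (fun t => l *: f t).
Proof.
move=> rf.
have [->|l0] := eqVneq l 0.
  rewrite (_ : (fun t => 0 *: f t) = cst 0); first exact: realisable0.
  by apply/funext => t; rewrite scale0r.
have [->|l1] := eqVneq l 1.
  by rewrite (_ : (fun t => 1 *: f t) = f) //; apply/funext => t; rewrite scale1r.
have [M M0 fM] := realisable_box rf.
pose k := vec (M + 1) 0.
(* scale about a far centre [k], which [f] never meets, then translate back *)
rewrite (_ : (fun t => l *: f t) =
  (fun t => (k + l *: (f t - k)) + cst ((l - 1) *: k) t)); last first.
  by apply/funext => t; apply: vec_eq; rewrite !mxE /=; ring.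
apply: realisableD; last exact: realisable_cst.
apply: realisable_pantograph => //; first exact: realisable_cst.
move=> t; apply/negP => /eqP /(congr1 (fun u : 'rV[R]_2 => u 0 0)).
by rewrite mxE /=; have [] := fM t; rewrite !ler_norml => /andP[]; lra.
Qed.

(** Approximants within [e] are shifted by [2 * e]: they stay near the limit but no
longer meet it. *)
Lemma realisable_limit c : continuous c ->
  (forall e, 0 < e -> exists2 f, realisable f &
     forall t, `|f t 0 0 - c t 0 0| <= e /\ `|f t 0 1 - c t 0 1| <= e) ->
  realisable c.
Proof.
move=> cc app.
pose e n : R := n.+1%:R^-1.
have e0 n : 0 < e n by rewrite invr_gt0.
have /choice[x xP] n : exists f, realisable f /\
    forall t, `|f t 0 0 - c t 0 0| <= e n /\ `|f t 0 1 - c t 0 1| <= e n.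
  by have [f rf fP] := app (e n) (e0 n); exists f.
apply: (@realisable_limit_strict _ _ (fun n t => x n t + cst (vec (2 * e n) 0) t)
  (fun n => 2 * e n)) => //.
- move=> n; apply: realisableD; last exact: realisable_cst.
  by case: (xP n).
- move=> d d0.
  exists (Num.bound (4 / d)).
  have dd := archi_boundP (divr_ge0 (ler0n R 4) (ltW d0)).
  rewrite ltr_pdivrMr // in dd.
  have b1 : (0 : R) < (Num.bound (4 / d)).+1%:R by rewrite ltr0n.
  rewrite exprMn expr2 /e exprVn -natrM ltr_pdivrMr ?exprn_gt0 //.
  apply: lt_le_trans dd _; rewrite mulrC ler_pM2l // -natrX ler_nat.
  by rewrite (leq_trans (leqnSn _)) // leq_pmulr.
- move=> n t; apply/negP => /eqP /(congr1 (fun u : 'rV[R]_2 => u 0 0)).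
  have [_ /(_ t)[+ _]] := xP n; rewrite !mxE /= ler_norml => /andP[].
  by have := e0 n; lra.
- move=> n t.
  have [_ /(_ t)[]] := xP n; rewrite dotpE !mxE /= !ler_norml.
  have := e0 n; move: (e n) (x n t 0 0) (x n t 0 1) (c t 0 0) (c t 0 1).
  by move=> d x0 x1 c0 c1 d0 /andP[h1 h2] /andP[h3 h4]; nra.
Qed.

End Closure.

(** * Scalar estimates, and approximation by smoothed steps *)

Section Estimates.
Variable R : realType.
Implicit Types (a b d e M N r x y : R).

Lemma le_of_sqr_le a b : 0 <= b -> a ^+ 2 <= b ^+ 2 -> a <= b.
Proof. by move=> b0 ab; rewrite leNgt; apply/negP => ba; move: ab; rewrite !expr2; nra. Qed.

Lemma sqr_norm_le a b : `|a| <= b -> a ^+ 2 <= b ^+ 2.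
Proof. by rewrite ler_norml => /andP[? ?]; rewrite !expr2; nra. Qed.

(** In the plane these are coordinates of the rescaled apex and of the unit
normal, for a base of length [N] and legs [r]. *)
Lemma normal_estimate r N x : 0 < N -> 0 < r -> N ^+ 2 < 4 * r ^+ 2 ->
  `|x| <= N ->
  `|r^-1 * (Num.sqrt (r ^+ 2 / N ^+ 2 - 4^-1) * x) - N^-1 * x| <= N ^+ 2 / (4 * r ^+ 2).
Proof.
move=> N0 r0 Nr xN.
set k := Num.sqrt _.
have k0 : 0 <= k by exact: sqrtr_ge0.
have r20 : 0 < r ^+ 2 by rewrite exprn_gt0.
have N20 : 0 < N ^+ 2 by rewrite exprn_gt0.
have kk : (k * N) ^+ 2 = r ^+ 2 - 4^-1 * N ^+ 2.
  rewrite exprMn /k sqr_sqrtr; first by rewrite mulrBl divfK // gt_eqF.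
  by rewrite subr_ge0 ler_pdivlMr // ler_pdivrMl // ltW.
have kN0 : 0 <= k * N by rewrite mulr_ge0 // ltW.
have kNr : k * N <= r by apply: le_of_sqr_le; [exact: ltW|rewrite kk; lra].
have -> : r^-1 * (k * x) - N^-1 * x = - ((r - k * N) * x / (r * N)).
  by field; rewrite !gt_eqF.
rewrite normrN normrM normrM (ger0_norm (x := r - _)) ?subr_ge0 //.
rewrite (gtr0_norm (x := (r * N)^-1)) ?invr_gt0 ?mulr_gt0 //.
rewrite ler_pdivrMr ?mulr_gt0 //.
apply: (@le_trans _ _ ((r - k * N) * N)); first by rewrite ler_wpM2l // subr_ge0.
have -> : N ^+ 2 / (4 * r ^+ 2) * (r * N) = N ^+ 2 / (4 * r) * N.
  by field; rewrite gt_eqF.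
rewrite ler_wpM2r ?(ltW N0) // ler_pdivlMr ?mulr_gt0 //.
by move: (k * N) kk kN0 kNr => z zz z0 zr; nra.
Qed.

(** First order expansion of the unit vector along [(1 + d * a, d * b)], with
explicit constants. *)
Lemma nearly_unit_estimate a b d M : 0 < d -> 0 < M -> d * M <= 4^-1 ->
  `|a| <= M -> `|b| <= M ->
  let N := Num.sqrt ((1 + d * a) ^+ 2 + (d * b) ^+ 2) in
  `|b / N - b| <= 3 * M ^+ 2 * d /\ `|d^-1 * ((1 + d * a) / N - 1)| <= 3 * M ^+ 2 * d.
Proof.
move=> d0 M0 dM aM bM N.
have ad : `|d * a| <= d * M by rewrite normrM gtr0_norm // ler_pM2l.
have bd : `|d * b| <= d * M by rewrite normrM gtr0_norm // ler_pM2l.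
have /andP[adl adr] : - (d * M) <= d * a <= d * M by rewrite -ler_norml.
have b2 : (d * b) ^+ 2 <= (d * M) ^+ 2 by exact: sqr_norm_le.
have NN : N ^+ 2 = (1 + d * a) ^+ 2 + (d * b) ^+ 2.
  by rewrite sqr_sqrtr // addr_ge0 ?sqr_ge0.
have u0 : 3 / 4 <= 1 + d * a by lra.
have N0 : 0 <= N by exact: sqrtr_ge0.
have uN : 1 + d * a <= N.
  by apply: le_of_sqr_le => //; rewrite NN lerDl sqr_ge0.
have Npos : 0 < N by lra.
have Nu : N - (1 + d * a) <= (d * M) ^+ 2.
  have h : (N - (1 + d * a)) * (N + (1 + d * a)) = (d * b) ^+ 2 by rewrite -subr_sqr NN; ring.
  move: b2; rewrite -h; move: (1 + d * a) u0 uN => u u0 uN; nra.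
have dMd : (d * M) ^+ 2 <= 4^-1 * (d * M).
  by rewrite expr2 ler_wpM2r // mulr_ge0 ?ltW.
have N1 : `|N - 1| <= 2 * (d * M) by rewrite ler_norml; apply/andP; split; lra.
split.
- have -> : b / N - b = - (b * (N - 1) / N) by field; rewrite gt_eqF.
  rewrite normrN 2!normrM (gtr0_norm (x := N^-1)) ?invr_gt0 // ler_pdivrMr //.
  apply: (@le_trans _ _ (M * (2 * (d * M)))); first by rewrite ler_pM.
  have : 0 < M ^+ 2 * d by rewrite mulr_gt0 ?exprn_gt0.
  by move=> h; rewrite (_ : M * (2 * (d * M)) = 2 * (M ^+ 2 * d)); [nra|ring].
- have -> : d^-1 * ((1 + d * a) / N - 1) = - ((N - (1 + d * a)) / (d * N)).
    by field; rewrite !gt_eqF.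
  rewrite normrN normrM (gtr0_norm (x := (d * N)^-1)) ?invr_gt0 ?mulr_gt0 //.
  rewrite ger0_norm ?subr_ge0 // ler_pdivrMr ?mulr_gt0 //.
  apply: (le_trans Nu).
  have : 0 < M ^+ 2 * d ^+ 2 by rewrite mulr_gt0 ?exprn_gt0.
  have -> : 3 * M ^+ 2 * d * (d * N) = 3 * N * (M ^+ 2 * d ^+ 2) by ring.
  by rewrite exprMn mulrC => h; nra.
Qed.

Definition smooth_sign d y : R := y / Num.sqrt (y ^+ 2 + d ^+ 2).

Lemma smooth_sign_estimate d y : 0 < d -> y != 0 ->
  `|smooth_sign d y - Num.sg y| <= d ^+ 2 / y ^+ 2.
Proof.
move=> d0; rewrite neq_lt.
wlog y0 : y / 0 < y => [h /orP[yl|yg]|_].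
- have := h (- y); rewrite oppr_gt0 /smooth_sign sqrrN sgrN mulNr -opprD normrN.
  by apply=> //; rewrite yl orbT.
- by apply: h => //; rewrite yg orbT.
rewrite gtr0_sg // /smooth_sign.
set N := Num.sqrt _.
have N0 : 0 <= N by exact: sqrtr_ge0.
have NN : N ^+ 2 = y ^+ 2 + d ^+ 2 by rewrite sqr_sqrtr // addr_ge0 ?sqr_ge0.
have yN : y <= N by apply: le_of_sqr_le => //; rewrite NN lerDl sqr_ge0.
have Npos : 0 < N by exact: lt_le_trans yN.
have -> : y / N - 1 = - ((N - y) / N) by field; rewrite gt_eqF.
rewrite normrN ger0_norm ?divr_ge0 ?subr_ge0 //.
rewrite ler_pdivrMr // mulrAC ler_pdivlMr ?exprn_gt0 //.
have -> : d ^+ 2 = (N - y) * (N + y) by rewrite -[LHS](addKr (y ^+ 2)) -NN; ring.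
by rewrite -mulrA ler_wpM2l ?subr_ge0 //; nra.
Qed.

Lemma smooth_sign_le1 d y : 0 < d -> `|smooth_sign d y| <= 1.
Proof.
move=> d0; rewrite /smooth_sign.
have h : 0 < y ^+ 2 + d ^+ 2 by rewrite ltr_wpDl ?sqr_ge0 ?exprn_gt0.
rewrite normrM (gtr0_norm (x := (Num.sqrt _)^-1)) ?invr_gt0 ?sqrtr_gt0 // ler_pdivrMr ?sqrtr_gt0 // mul1r.
by rewrite -sqrtr_sqr ler_sqrt // ?lerDl ?sqr_ge0 // ltW.
Qed.

End Estimates.

Section StepDensity.
Variables (R : realType) (x : R -> R) (L : set (R -> R)).
Hypothesis x01 : forall t, 0 <= x t <= 1.
Hypothesis Lx : L x.
Hypothesis Lcst : forall k : R, L (fun=> k).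
Hypothesis LD : forall f g : R -> R, L f -> L g -> L (fun t => f t + g t).
Hypothesis LZ : forall (k : R) (f : R -> R), L f -> L (fun t => k * f t).
Hypothesis Lsign : forall (d : R) (f : R -> R), 0 < d -> L f ->
  L (fun t => smooth_sign d (f t)).

Let step (d y : R) : R := 2^-1 + 2^-1 * smooth_sign d y.

Lemma step_estimate (d y h : R) (p : bool) : 0 < d -> 0 < h -> h <= `|y| ->
  p = (0 < y) ->
  `|step d y - p%:R| <= d ^+ 2 / h ^+ 2.
Proof.
move=> d0 h0 hy ->.
have y0 : y != 0 by rewrite -normr_gt0 (lt_le_trans h0).
have -> : (0 < y)%R%:R = 2^-1 + 2^-1 * Num.sg y :> R.
  move: y0; rewrite neq_lt => /orP[yl|yg].
    by rewrite ltr0_sg // (lt_gtF yl) /=; lra.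
  by rewrite gtr0_sg // yg /=; lra.
rewrite /step opprD addrACA subrr add0r -mulrBr normrM gtr0_norm ?invr_gt0 //.
apply: (@le_trans _ _ `|smooth_sign d y - Num.sg y|).
  by rewrite ler_piMl // invf_le1 // ler1n.
apply: le_trans (smooth_sign_estimate d0 y0) _.
have hy2 : h ^+ 2 <= y ^+ 2.
  rewrite -(real_normK (num_real y)); apply: sqr_norm_le.
  by rewrite (ger0_norm (ltW h0)).
have h20 : 0 < h ^+ 2 by rewrite exprn_gt0.
by rewrite ler_pM2l ?exprn_gt0 // lef_pV2 // posrE (lt_le_trans h20).
Qed.

Lemma step_crude (d y : R) (p : bool) : 0 < d -> `|step d y - p%:R| <= 1.
Proof.
move=> d0; have := smooth_sign_le1 y d0; rewrite /step !ler_norml => /andP[h1 h2].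
by case: p => /=; apply/andP; split; lra.
Qed.

(** With break points [k / n] the sum of increments of [phi] times true steps is
[phi] at the last break point before [x t].  Replacing a true step by a smoothed
one costs at most one increment at the two break points adjacent to [x t], and
a fraction [1 / n] of an increment at each of the others. *)
Lemma step_dense (phi : R -> R) (e : R) : 0 < e ->
  (exists2 d, 0 < d & forall s s', 0 <= s <= 1 -> 0 <= s' <= 1 ->
    `|s - s'| < d -> `|phi s - phi s'| <= e) ->
  exists2 g, L g & forall t, `|g t - phi (x t)| <= 4 * e.
Proof.
move=> e0 [d d0 mod].
pose n := (Num.bound d^-1).+1.
have n0 : 0 < n%:R :> R by rewrite ltr0n.
have nd : n%:R^-1 < d.
  rewrite invf_plt ?posrE //.
  by apply: lt_trans (archi_boundP _) _; rewrite ?invr_ge0 ?ltW // ltr_nat.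
have n1 : 1 <= n%:R :> R by rewrite ler1n.
pose y (k : nat) : R := k%:R / n%:R.
have y01 k : (k <= n)%N -> 0 <= y k <= 1.
  by move=> kn; rewrite divr_ge0 //= ler_pdivrMr // mul1r ler_nat.
(* the error of a smoothed step at distance [1 / n] is [eta ^ 2 * n ^ 2 <= 1 / n] *)
pose eta : R := n%:R ^- 2.
have eta0 : 0 < eta by rewrite invr_gt0 exprn_gt0.
pose D k : R := phi (y k.+1) - phi (y k).
have De k : (k < n)%N -> `|D k| <= e.
  move=> kn; apply: mod; [exact: y01|exact: y01 (ltnW kn)|].
  rewrite -mulrBl -natrB // subSnn mul1r ger0_norm //.
pose g t := phi 0 + \sum_(k < n) D k * step eta (x t - y k.+1).
exists g.
  apply: LD => //.
  have Lsum m : L (fun t => \sum_(k < m) D k * step eta (x t - y k.+1)).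
    elim: m => [|m IH].
      by rewrite (_ : (fun t => _) = fun=> 0) //; apply/funext => t; rewrite big_ord0.
    rewrite (_ : (fun t => _) = fun t => (\sum_(k < m) D k * step eta (x t - y k.+1))
      + D m * step eta (x t - y m.+1)); last by apply/funext => t; rewrite big_ord_recr.
    apply: LD => //; apply: LZ; rewrite /step.
    by apply: LD => //; apply: LZ; apply: Lsign => //; apply: LD.
  exact: Lsum.
move=> t; have /andP[x0 x1] := x01 t.
pose j := Num.trunc (n%:R * x t).
have /andP[jx xj] : j%:R <= n%:R * x t < j.+1%:R.
  by apply: truncn_itv; rewrite mulr_ge0 // ltW.
have jn : (j <= n)%N.
  by rewrite -(ler_nat R) (le_trans jx) // ler_piMr // ltW.
have tel : phi (y j) = phi 0 + \sum_(k < n) D k * (k < j)%:R.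
  have -> : \sum_(k < n) D k * (k < j)%:R = \sum_(0 <= k < j) D k.
    rewrite big_mkord (big_ord_widen n D jn) [RHS]big_mkcond /=; apply: eq_bigr => k _.
    by case: ifP; rewrite (mulr1, mulr0).
  by rewrite telescope_sumr // /y mul0r addrC subrK.
have yx : `|phi (y j) - phi (x t)| <= e.
  apply: mod; [exact: y01|by rewrite x0|].
  apply: le_lt_trans nd.
  rewrite distrC ger0_norm; last by rewrite subr_ge0 ler_pdivrMr // mulrC.
  rewrite lerBlDr /y -{1}[n%:R^-1]mul1r -mulrDl ler_pdivlMr // mulrC ltW // (lt_le_trans xj) //.
  by rewrite -natr1 addrC.
have -> : g t - phi (x t) =
    \sum_(k < n) D k * (step eta (x t - y k.+1) - (k < j)%:R) + (phi (y j) - phi (x t)).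
  under eq_bigr do rewrite mulrBr.
  by rewrite sumrB tel /g; ring.
apply: le_trans (ler_normD _ _) _.
suff sum3 : `|\sum_(k < n) D k * (step eta (x t - y k.+1) - (k < j)%:R)| <= 3 * e by lra.
apply: le_trans (ler_norm_sum _ _ _) _.
apply: (@le_trans _ _ (\sum_(k < n) e * (n%:R^-1 + (k == j :> nat)%:R + (k.+1 == j)%:R))).
  apply: ler_sum => k _; rewrite normrM ler_pM //; first exact: De.
  have [->|kj] := eqVneq (k : nat) j.
    apply: le_trans (step_crude _ _ eta0) _.
    by rewrite addrAC lerDr addr_ge0 // invr_ge0 ltW.
  have [kj1|kj1] := eqVneq k.+1 j.
    apply: le_trans (step_crude _ _ eta0) _.
    by rewrite addr0 lerDr // invr_ge0 ltW.
  rewrite !addr0.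
  have cases : (k < j)%N /\ (k.+2 <= j)%N \/ (j < k)%N.
    by move: kj kj1; case: (ltngtP k j) => // h _; [left; split=> //; rewrite ltn_neqAle kj1|right].
  have far : n%:R^-1 <= `|x t - y k.+1| /\ (k < j)%N = (0 < x t - y k.+1).
    have xe : x t - y k.+1 = (n%:R * x t - k.+1%:R) / n%:R.
      by rewrite /y; field; rewrite gt_eqF.
    have nV : 0 < n%:R^-1 :> R by rewrite invr_gt0.
    case: cases => [[kj' kj2]|jk].
      have h : 1 <= n%:R * x t - k.+1%:R.
        by rewrite lerBrDl natr1 (le_trans _ jx) // ler_nat.
      have h' : n%:R^-1 <= x t - y k.+1 by rewrite xe ler_peMl // ltW.
      by rewrite kj' (lt_le_trans nV h') ger0_norm // (le_trans (ltW nV)).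
    have h : 1 <= k.+1%:R - n%:R * x t.
      rewrite lerBrDl; apply: (@le_trans _ _ (j.+1%:R + 1)); first by rewrite lerD2r ltW.
      by rewrite natr1 ler_nat.
    have h' : n%:R^-1 <= y k.+1 - x t.
      by rewrite -opprB xe -mulNr opprB ler_peMl // ltW.
    rewrite distrC ger0_norm ?(le_trans (ltW nV)) //; split=> //.
    rewrite ltnNge (ltnW jk) /=; apply/esym/negbTE; rewrite -leNgt; lra.
  apply: le_trans (step_estimate eta0 _ far.1 far.2) _; first by rewrite invr_gt0.
  rewrite /eta (_ : _ / _ = n%:R ^- 2 :> R); last by field; rewrite gt_eqF.
  rewrite lef_pV2 ?posrE ?exprn_gt0 // expr2 ler_peMl // ltW.
rewrite -mulr_sumr !big_split /= mulrC.
rewrite ler_pM2r //.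
have one (i : nat) : \sum_(k < n) ((k == i :> nat)%:R : R) <= 1.
  have [lt|ge] := ltnP i n.
    rewrite (bigD1 (Ordinal lt)) //= eqxx big1 ?addr0 // => k.
    by rewrite -val_eqE /= => /negbTE ->.
  by rewrite big1 // => k _; rewrite ltn_eqF // (leq_trans (ltn_ord k)).
have one' : \sum_(k < n) ((k.+1 == j)%:R : R) <= 1.
  case: (j) => [|i]; first by rewrite big1.
  by apply: le_trans (one i).
rewrite sumr_const card_ord -(mulr_natl n%:R^-1) divff ?gt_eqF //.
by have := one j; lra.
Qed.

End StepDensity.

(** * Unit normals, projections, and realisation of every curve *)

Section Projections.
Variables (R : realType) (v : motion R).
Hypothesis v_continuous : continuous v.
Hypothesis v_unit : forall t, dotp (v t) (v t) = 1.
Hypothesis v_offaxis : forall t, v t 0 1 != 0.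
Implicit Types (f g : motion R) (l : R).
Local Notation realisable := (realisable (crank v)).

Lemma normal_continuous f : continuous f -> (forall t, f t != 0) ->
  continuous (fun t => (enorm (f t))^-1 *: perp (f t)).
Proof.
move=> cf f0 t; apply: cvgZ; last exact: perp_continuous.
apply: cvgV; first by rewrite gt_eqF // sqrtr_gt0 dotp_gt0.
exact: (sqrt_comp_continuous (dotp_continuous cf)).
Qed.

(** The unit normal is the limit, for [r] tending to infinity, of [r^-1] times the
height of the isosceles triangle with legs [r] over the segment from [0] to
[f]. *)
Lemma realisable_normal f : realisable f -> (forall t, f t != 0) ->
  realisable (fun t => (enorm (f t))^-1 *: perp (f t)).
Proof.
move=> rf f0.
apply: realisable_limit => //.
  exact: (normal_continuous (realisable_continuous rf) f0).
move=> e e0.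
have [M fM] := realisable_bounded v_unit rf.
have M0 : 0 <= M by apply: le_trans (fM 0); exact: dotp_ge0.
(* legs long enough for the triangles to exist and for the error [M / (4 * r ^ 2)] *)
pose r := 1 + M + M / e.
have Me : 0 <= M / e by rewrite divr_ge0 // ltW.
have r1 : 1 <= r by rewrite /r; lra.
have r0 : 0 < r by lra.
have rr : r <= r ^+ 2 by rewrite expr2 ler_peMl // ltW.
have fr t : dotp (f t) (f t) < 4 * r ^+ 2 by move: (fM t); rewrite /r in rr *; lra.
have rer : M <= e * (4 * r ^+ 2).
  have : M <= e * r.
    have : 0 <= e * (1 + M) by rewrite mulr_ge0 ?ltW //; lra.
    by have -> : e * r = e * (1 + M) + M by [rewrite /r; field; rewrite gt_eqF]; lra.
  move=> h; apply: (le_trans h); rewrite ler_pM2l //; lra.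
exists (fun t => r^-1 *: (apex r 0 (f t) + (- 2^-1) *: f t)).
  apply: realisableZ => //; apply: realisableD => //; last exact: realisableZ.
  apply: realisable_apex => //; first exact: realisable0.
    by move=> t; rewrite eq_sym.
  by move=> t; rewrite subr0.
move=> t.
have N0 : 0 < enorm (f t) by rewrite sqrtr_gt0 dotp_gt0.
have NN : enorm (f t) ^+ 2 = dotp (f t) (f t) by rewrite sqr_sqrtr // dotp_ge0.
have coord x : x ^+ 2 <= dotp (f t) (f t) -> `|x| <= enorm (f t).
  by move=> h; rewrite -sqrtr_sqr ler_sqrt ?dotp_ge0.
have est x : `|x| <= enorm (f t) ->
  `|r^-1 * (Num.sqrt (r ^+ 2 / dotp (f t) (f t) - 4^-1) * x) - (enorm (f t))^-1 * x| <= e.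
  move=> h; rewrite -NN; apply: le_trans (normal_estimate N0 r0 _ h) _; rewrite NN //.
  rewrite ler_pdivrMr ?mulr_gt0 ?exprn_gt0 //; exact: le_trans (fM t) _.
have -> : r^-1 *: (apex r 0 (f t) + (- 2^-1) *: f t) =
  r^-1 *: (Num.sqrt (r ^+ 2 / dotp (f t) (f t) - 4^-1) *: perp (f t)).
  by rewrite /apex subr0 add0r scaleNr addrC addKr.
split; rewrite !mxE /=; apply: est; apply: coord; rewrite dotpE -!expr2.
  by rewrite sqrrN lerDr sqr_ge0.
by rewrite lerDl sqr_ge0.
Qed.

(** The unit normal to [w + d *: f] is [perp w] minus [d] times the stated motion,
up to order [d ^ 2]; so the motion is a limit of difference quotients of
realisable motions. *)
Lemma realisable_projection (w : 'rV[R]_2) f : dotp w w = 1 -> realisable f ->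
  realisable (fun t => dotp (f t) (perp w) *: w).
Proof.
move=> w1 rf; have cf := realisable_continuous rf.
have w1' : w 0 0 ^+ 2 = 1 - w 0 1 ^+ 2 by rewrite -w1 dotpE; ring.
have w0 : `|w 0 0| <= 1 by rewrite ler_norml; apply/andP; split; nra.
have w0' : `|w 0 1| <= 1 by rewrite ler_norml; apply/andP; split; nra.
have ch : continuous (fun t => dotp (f t) (perp w)).
  have -> : (fun t => dotp (f t) (perp w)) = (fun t => f t 0 0 * - w 0 1 + f t 0 1 * w 0 0).
    by apply/funext => s; rewrite dotpE !mxE.
  by move=> t; apply: cvgD; (apply: cvgM; last exact: cvg_cst);
    (apply: coord0_continuous || apply: coord1_continuous).
apply: realisable_limit => //.
  by move=> t; apply: cvgZr_tmp; exact: ch.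
move=> e e0.
have [M0 fM0] := realisable_bounded v_unit rf.
have M00 : 0 <= M0 by apply: le_trans (fM0 0); exact: dotp_ge0.
pose M := M0 + 1; have M1 : 0 < M by rewrite /M; lra.
have fM t : `|dotp (f t) w| <= M /\ `|dotp (f t) (perp w)| <= M.
  have h : dotp (f t) w ^+ 2 + dotp (f t) (perp w) ^+ 2 <= M0.
    apply: le_trans (fM0 t); rewrite -[leRHS]mulr1 -w1 le_eqVlt; apply/orP; left.
    by apply/eqP; rewrite !dotpE !mxE /=; ring.
  by rewrite !ler_norml /M; split; apply/andP; split; nra.
have [d [d0 dM de]] : exists d, [/\ 0 < d, d * M <= 4^-1 & 6 * M ^+ 2 * d <= e].
  have h1 : 0 <= 6 * M ^+ 2 / e by rewrite !mulr_ge0 ?invr_ge0 ?ltW.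
  have k1 : 0 < 4 * M + 6 * M ^+ 2 / e by lra.
  (* both coordinate errors, each [3 * M ^ 2 * d], may add up in the basis [w, perp w] *)
  exists (4 * M + 6 * M ^+ 2 / e)^-1; split; first by rewrite invr_gt0.
  - by rewrite mulrC ler_pdivrMr //; lra.
  - rewrite ler_pdivrMr //.
    have -> : e * (4 * M + 6 * M ^+ 2 / e) = e * (4 * M) + 6 * M ^+ 2.
      by field; rewrite gt_eqF.
    by rewrite lerDr !mulr_ge0 // ltW.
pose D t := w + d *: f t.
have DD t : dotp (D t) (D t) = (1 + d * dotp (f t) w) ^+ 2 + (d * dotp (f t) (perp w)) ^+ 2.
  transitivity (dotp w w * (1 + 2 * d * dotp (f t) w) +
    d ^+ 2 * (dotp (f t) w ^+ 2 + dotp (f t) (perp w) ^+ 2)); last by rewrite w1; ring.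
  have -> : dotp (f t) w ^+ 2 + dotp (f t) (perp w) ^+ 2 = dotp (f t) (f t) * dotp w w.
    by rewrite !dotpE !mxE /=; ring.
  by rewrite w1 !dotpE /D !mxE; ring: w1'.
have rD : realisable D.
  by apply: (realisableD v_continuous v_unit v_offaxis (f := cst w)) => //;
    [exact: realisable_cst|exact: realisableZ].
have Dpos t : 0 < dotp (D t) (D t).
  have [h _] := fM t.
  have : `|d * dotp (f t) w| <= 4^-1.
    by rewrite normrM gtr0_norm // (le_trans _ dM) // ler_pM2l.
  rewrite DD ler_norml => /andP[h1 _].
  by rewrite ltr_wpDr ?sqr_ge0 // exprn_gt0 //; lra.
have D0 t : D t != 0.
  apply/negP => /eqP h; have := Dpos t; rewrite h dotpE !mxE mulr0 addr0 ltxx //.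
exists (fun t => (- d^-1) *: ((enorm (D t))^-1 *: perp (D t) + cst (- perp w) t)).
  by apply: realisableZ => //; apply: realisableD => //;
    [exact: realisable_normal|exact: realisable_cst].
move=> t; have [fa fb] := fM t.
have [] := nearly_unit_estimate d0 M1 dM fa fb.
rewrite -DD -/(enorm _).
have N0 : 0 < enorm (D t) by rewrite sqrtr_gt0.
have pD : perp (D t) = (1 + d * dotp (f t) w) *: perp w - (d * dotp (f t) (perp w)) *: w.
  by apply: vec_eq; rewrite !dotpE /D !mxE /=; ring: w1'.
move: (dotp (f t) w) (dotp (f t) (perp w)) pD => a b pD.
set p := b / _ - b; set q := d^-1 * _ => hp hq.
have -> : (- d^-1) *: ((enorm (D t))^-1 *: perp (D t) + cst (- perp w) t) =
    b *: w + (p *: w - q *: perp w).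
  apply: vec_eq; rewrite pD !mxE /= /p /q; field; rewrite !gt_eqF //.
clearbody p q.
have bound (z z' : R) : `|z| <= 1 -> `|z'| <= 1 -> `|p * z - q * z'| <= e.
  move=> z1 z1'; apply: le_trans de; apply: le_trans (ler_normB _ _) _.
  rewrite !normrM.
  have -> : 6 * M ^+ 2 * d = 3 * M ^+ 2 * d + 3 * M ^+ 2 * d by ring.
  by apply: lerD; [apply: le_trans hp|apply: le_trans hq]; rewrite ler_piMr.
split; rewrite [X in `|X - _|]mxE addrAC subrr add0r !mxE /=; apply: bound => //.
by rewrite normrN.
Qed.

(** Scalar functions are encoded by motions along the first axis. *)
Definition axial (h : R -> R) : Prop := realisable (fun t => vec (h t) 0).

Lemma axial_coord1 f : realisable f -> axial (fun t => f t 0 1).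
Proof.
move=> rf; have u1 : dotp (vec 1 0 : 'rV[R]_2) (vec 1 0) = 1 by rewrite dotpE !mxE /=; ring.
rewrite /axial (_ : (fun t => _) = fun t => dotp (f t) (perp (vec 1 0)) *: vec 1 0).
  exact: realisable_projection.
by apply/funext => t; apply: vec_eq; rewrite !dotpE !mxE /=; ring.
Qed.

Lemma realisable_coord0 f : realisable f -> realisable (fun t => vec 0 (f t 0 0)).
Proof.
move=> rf; have u1 : dotp (vec 0 1 : 'rV[R]_2) (vec 0 1) = 1 by rewrite dotpE !mxE /=; ring.
rewrite (_ : (fun t => _) = fun t => (-1) *: (dotp (f t) (perp (vec 0 1)) *: vec 0 1)).
  by apply: realisableZ => //; exact: realisable_projection.
by apply/funext => t; apply: vec_eq; rewrite !dotpE !mxE /=; ring.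
Qed.

Lemma axial_coord0 f : realisable f -> axial (fun t => f t 0 0).
Proof.
move=> /realisable_coord0/axial_coord1; rewrite /axial.
by under eq_fun do rewrite vec1.
Qed.

Lemma realisable_vec (h k : R -> R) : axial h -> axial k ->
  realisable (fun t => vec (h t) (k t)).
Proof.
move=> rh /realisable_coord0 rk.
rewrite (_ : (fun t => _) = fun t => vec (h t) 0 + vec 0 (vec (k t) 0 0 0)).
  exact: realisableD.
by apply/funext => t; apply: vec_eq; rewrite !mxE /=; ring.
Qed.

Lemma axial_cst (k : R) : axial (fun=> k).
Proof. exact: realisable_cst. Qed.

Lemma axialD (h k : R -> R) : axial h -> axial k -> axial (fun t => h t + k t).
Proof.
move=> rh rk; rewrite /axial (_ : (fun t => _) = fun t => vec (h t) 0 + vec (k t) 0).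
  exact: realisableD.
by apply/funext => t; apply: vec_eq; rewrite !mxE /= ?addr0.
Qed.

Lemma axialZ (l : R) (h : R -> R) : axial h -> axial (fun t => l * h t).
Proof.
move=> rh; rewrite /axial (_ : (fun t => _) = fun t => l *: vec (h t) 0).
  exact: realisableZ.
by apply/funext => t; apply: vec_eq; rewrite !mxE /= ?mulr0.
Qed.

Lemma axial_smooth_sign (d : R) (h : R -> R) : 0 < d -> axial h ->
  axial (fun t => smooth_sign d (h t)).
Proof.
move=> d0 rh.
have rD := realisable_vec rh (axial_cst d).
have D0 t : vec (h t) d != 0.
  apply/negP => /eqP /(congr1 (fun u : 'rV[R]_2 => u 0 1)); rewrite !mxE /=.
  by move=> dd; move: d0; rewrite dd ltxx.
have := axial_coord1 (realisable_normal rD D0); rewrite /axial.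
rewrite [X in _ -> realisable X](_ : _ = fun t => vec (((enorm (vec (h t) d))^-1 *:
  perp (vec (h t) d)) 0 1) 0) //.
apply/funext => t; congr vec; rewrite !mxE /= mulrC /smooth_sign /enorm dotpE !mxE /=.
by rewrite !expr2.
Qed.

Lemma axial_limit (h : R -> R) : continuous h ->
  (forall e, 0 < e -> exists2 k, axial k & forall t, `|k t - h t| <= e) -> axial h.
Proof.
move=> ch app; apply: realisable_limit => //.
  apply: vec_continuous; first exact: ch.
  by move=> t; exact: cvg_cst.
move=> e e0; have [k rk kh] := app e e0; exists (fun t => vec (k t) 0) => // t.
by rewrite !vec0 !vec1 subrr normr0; split; [exact: kh|exact: ltW].
Qed.

End Projections.

Section Curves.
Variable R : realType.

Definition clamp (t : R) : R := Num.min (Num.max t 0) 1.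

Lemma clamp01 t : 0 <= clamp t <= 1.
Proof. by rewrite /clamp le_min le_max lexx ler01 orbT ge_min lexx orbT. Qed.

Lemma clamp_id t : 0 <= t <= 1 -> clamp t = t.
Proof. by move=> /andP[t0 t1]; rewrite /clamp max_l // min_l. Qed.

Lemma clamp_continuous : continuous clamp.
Proof.
move=> t.
have cmax : {for t, continuous (fun s : R => Num.max s 0)}.
  by apply: (@continuous_max _ _ (fun s : R => s) (fun=> 0)); [exact: cvg_id|exact: cvg_cst].
by apply: (@continuous_min _ _ (fun s : R => Num.max s 0) (fun=> 1)); [exact: cmax|exact: cvg_cst].
Qed.

(** Passing from the interval to the line: flexes, which are only known to be
continuous on the interval, become motions on the line. *)
Lemma clamp_comp_continuous (T : topologicalType) (f : R -> T) :
  {within `[0, 1], continuous f} -> continuous (f \o clamp).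
Proof.
move=> /subspace_continuousP cf t A /(cf (clamp t)) /=.
have ct : `[0, 1]%classic (clamp t) by rewrite /= in_itv /= clamp01.
move=> /(_ ct); rewrite nbhs_simpl /= /within /= => fA.
have near_t : \forall s \near t, clamp s \in `[0, 1] -> A (f (clamp s)).
  exact: (clamp_continuous (x := t) fA).
suff : \forall s \near t, A (f (clamp s)) by [].
apply: filterS near_t => s; apply.
by rewrite in_itv /= clamp01.
Qed.

Lemma uniformly_continuous01 (phi : R -> R) (e : R) :
  continuous (phi \o clamp) -> 0 < e ->
  exists2 d, 0 < d & forall s s', 0 <= s <= 1 -> 0 <= s' <= 1 ->
    `|s - s'| < d -> `|phi s - phi s'| <= e.
Proof.
move=> cphi e0.
have e20 : 0 < e / 2 by rewrite divr_gt0.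
have /compact_near_coveringP near01 : compact `[(0 : R), 1] by exact: segment_compact.
pose P (d s : R) := forall s', `|s - s'| < d ->
  `|(phi \o clamp) s - (phi \o clamp) s'| <= e.
have : \forall d \near (0 : R)^'+, `[0, 1]%classic `<=` P d.
  apply: near01 => s _.
  have /cvgrPdist_lt/(_ _ e20) /nbhs_ballP[r /= r0 ball_r] := cphi s.
  have r20 : 0 < r / 2 by rewrite divr_gt0.
  exists (ball s (r / 2), [set d | 0 < d < r / 2]) => /=.
    split; first exact: nbhsx_ballx.
    near=> d; apply/andP; split; near: d; [exact: nbhs_right_gt|exact: nbhs_right_lt].
  move=> [s1 d] /= [s1s /andP[d0 dr]] s2 s12.
  have b1 : `|s - s1| < r by apply: lt_trans s1s _; lra.
  have b2 : `|s - s2| < r.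
    by apply: le_lt_trans (ler_distD s1 _ _) _; rewrite /ball /= in s1s; lra.
  have h1 := ball_r _ b1; have h2 := ball_r _ b2.
  apply: le_trans (ler_distD ((phi \o clamp) s) _ _) _.
  rewrite (distrC ((phi \o clamp) s1)).
  by rewrite /= in h1 h2 *; lra.
move=> near_P.
have [d [d0 Pd]] := filter_ex (filterI (nbhs_right_gt (0 : R)) near_P).
exists d => // s s' s01 s01' ss'.
have := Pd s _ s' ss'; rewrite /= !clamp_id //; apply.
by rewrite in_itv.
Unshelve. all: by end_near.
Qed.

Section RealisedCurves.
Variable v : motion R.
Hypothesis v_continuous : continuous v.
Hypothesis v_unit : forall t, dotp (v t) (v t) = 1.
Hypothesis v_offaxis : forall t, v t 0 1 != 0.
Hypothesis v_clamp : axial v clamp.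

Lemma axial_comp_clamp (phi : R -> R) :
  continuous (phi \o clamp) -> axial v (phi \o clamp).
Proof.
move=> cphi; apply: axial_limit => //.
move=> e e0; have e40 : 0 < e / 4 by rewrite divr_gt0.
have [k rk kP] := step_dense clamp01 v_clamp (axial_cst v_continuous v_unit v_offaxis)
  (axialD v_continuous v_unit v_offaxis) (axialZ v_continuous v_unit v_offaxis)
  (axial_smooth_sign v_continuous v_unit v_offaxis) e40 (uniformly_continuous01 cphi e40).
by exists k => // t; apply: le_trans (kP t) _; rewrite mulrC divfK.
Qed.

Lemma realisable_comp_clamp (gamma : motion R) :
  {within `[0, 1], continuous gamma} -> realisable (crank v) (gamma \o clamp).
Proof.
move=> cg.
rewrite (_ : gamma \o clamp = fun t =>
  vec (((fun s => gamma s 0 0) \o clamp) t) (((fun s => gamma s 0 1) \o clamp) t)); last first.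
  by apply/funext => t; apply: vec_eq; rewrite mxE.
apply: realisable_vec => //; apply: axial_comp_clamp.
  exact: (coord0_continuous (clamp_comp_continuous cg)).
exact: (coord1_continuous (clamp_comp_continuous cg)).
Qed.

End RealisedCurves.
End Curves.

(** * From an assembly of motions to an infinite linkage *)

(** An enumeration of [S], repetitions allowed, with a choice of an index for each
element.  Repetitions make the index set infinite in all cases; copies of one
motion are joined by bars of length zero. *)
Lemma countable_indexing (T : Type) (S : set T) (c : T) : countable S -> S c ->
  exists (e : nat -> T) (idx : T -> nat),
    (forall n, S (e n)) /\ (forall f, S f -> e (idx f) = f).
Proof.
move=> /countable_injP[idx inj] Sc.
have /choice[e eP] : forall n, exists f, S f /\ forall g, S g -> idx g = n -> f = g.
  move=> n; have [[g Sg gn]|no] := pselect (exists2 g, S g & idx g = n).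
    exists g; split => // h Sh hn.
    by apply: inj; rewrite ?inE // gn hn.
  by exists c; split => // g Sg gn; case: no; exists g.
exists e, idx; split => [n|f Sf]; first by case: (eP n).
by have [_] := eP (idx f); apply.
Qed.

Section FrameworkOfAssembly.
Variables (R : realType) (e : nat -> motion R) (n2 n3 : nat).
Implicit Types (i j : option nat).

(** [None] is the hinge at the origin, adjacent to the indices [n2] and [n3] of the
crank only, although other joints keep a constant distance from it. *)
Definition bar i j : bool :=
  match i, j with
  | None, None => false
  | None, Some n | Some n, None => (n == n2) || (n == n3)
  | Some m, Some n => (m != n) && `[< rigid (e m) (e n) >]
  end.

Lemma bar_sym : symmetric bar.
Proof.
move=> [m|] [n|] //=; rewrite eq_sym; congr (_ && _).
by apply: asbool_equiv_eq; split; exact: rigidC.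
Qed.

Lemma bar_irr : irreflexive bar.
Proof. by move=> [m|] //=; rewrite eqxx. Qed.

Definition joint_motion (t : R) i : 'rV[R]_2 := if i is Some n then e n t else 0.

Definition joint_framework : framework R :=
  Framework bar_sym bar_irr (joint_motion 0).

Definition reach i j : Prop := exists s, path bar i s /\ last i s = j.

Lemma reach_refl i : reach i i.
Proof. by exists [::]. Qed.

Lemma reach_trans i j k : reach i j -> reach j k -> reach i k.
Proof.
by move=> [s [ps <-]] [s' [ps' <-]]; exists (s ++ s'); rewrite cat_path ps last_cat.
Qed.

Lemma reach_bar i j : bar i j -> reach i j /\ reach j i.
Proof.
by move=> ij; split; [exists [:: j]|exists [:: i]]; rewrite /= ?andbT // bar_sym.
Qed.

Lemma reach_rigid m n : rigid (e m) (e n) ->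
  reach (Some m) (Some n) /\ reach (Some n) (Some m).
Proof.
have [->|mn] := eqVneq m n; first by move=> _; split; exact: reach_refl.
by move=> r; apply: reach_bar; rewrite /= mn; apply/asboolP.
Qed.

Lemma infinite_joints : infinite_framework joint_framework.
Proof.
move=> fin; apply: infinite_nat.
rewrite -(preimage_setT (Some : nat -> option nat)).
by apply: finite_preimage fin => m n _ _ [].
Qed.

End FrameworkOfAssembly.

Section LinkageOfAssembly.
Variables (R : realType) (v : motion R).
Hypothesis v_unit : forall t, dotp (v t) (v t) = 1.
Hypothesis v_clamp : forall t, v (clamp t) = v t.
Hypothesis v_increasing : {in `[0, 1] &, {homo (fun t => v t 0 0) : s t / s < t}}.

(** A flex agreeing with the linkage at the hinge and at the crank deforms the
assembly and fixes the crank, so it fixes every motion; copies of a motion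
follow because they are joined by bars of length zero. *)
Lemma linkage_of_realisable (c : motion R) : realisable (crank v) c ->
  exists (F : framework R) (v1 v2 v3 vm : vertex F) (p : R -> vertex F -> 'rV[R]_2),
    infinite_linkage v1 v2 v3 p /\ forall t, p t vm = c t.
Proof.
move=> [S aS Sc].
have [e [idx [Se idxK]]] := countable_indexing (assembly_countable aS) Sc.
have Sx : S (cst (vec 1 0)) by apply: (assembly_base aS); left.
have Sv : S v by apply: (assembly_base aS); right.
have u0 : (0 : R) \in `[0, 1] by rewrite in_itv /= lexx ler01.
have u1 : (1 : R) \in `[0, 1] by rewrite in_itv /= lexx ler01.
have v01 : v 0 0 0 < v 1 0 0 by exact: (v_increasing u0 u1 ltr01).
have rigid_refl (f : motion R) : rigid f f by move=> t; rewrite !subrr.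
pose n2 := idx (cst (vec 1 0)); pose n3 := idx v.
have e2 : e n2 = cst (vec 1 0) by exact: idxK.
have e3 : e n3 = v by exact: idxK.
have norm2 : enorm (0 - vec 1 0 : 'rV[R]_2) = 1.
  by rewrite /enorm dotpE !mxE /= -[RHS]sqrtr1; congr Num.sqrt; ring.
pose F := joint_framework e n2 n3; pose p := joint_motion e.
pose v1 : vertex F := None; pose v2 : vertex F := Some n2; pose v3 : vertex F := Some n3.
exists F, v1, v2, v3, (Some (idx c)), p.
split; last by move=> t; rewrite /p /= idxK.
split.
- exact: infinite_joints.
- have hub (f : motion R) : S f -> forall n, e n = f ->
      reach e n2 n3 None (Some n) /\ reach e n2 n3 (Some n) None.
    have ends m : bar e n2 n3 None (Some m) -> forall n, e n = e m ->
        reach e n2 n3 None (Some n) /\ reach e n2 n3 (Some n) None.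
      move=> /reach_bar[r1 r2] n enm.
      have [r3 r4] : reach e n2 n3 (Some m) (Some n) /\ reach e n2 n3 (Some n) (Some m).
        by apply: reach_rigid; rewrite enm.
      by split; [exact: reach_trans r1 r3|exact: reach_trans r4 r2].
    move: f; apply: (assembly_connected aS (A := fun f => forall n, e n = f ->
      reach e n2 n3 None (Some n) /\ reach e n2 n3 (Some n) None)).
    + move=> f [->|->]; [rewrite -e2|rewrite -e3]; apply: ends => /=;
        by rewrite eqxx ?orbT.
    + move=> f g Sf Sg Af fg n eng.
      have [r1 r2] := Af _ (idxK f Sf).
      have [r3 r4] : reach e n2 n3 (Some (idx f)) (Some n) /\
          reach e n2 n3 (Some n) (Some (idx f)).
        by apply: reach_rigid; rewrite eng idxK.
      by split; [exact: reach_trans r1 r3|exact: reach_trans r4 r2].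
  have hub' (i : option nat) : reach e n2 n3 None i /\ reach e n2 n3 i None.
    by case: i => [n|]; [exact: (hub (e n))|split; exact: reach_refl].
  move=> x y; apply: (@reach_trans _ e n2 n3 x None y).
  + by case: (hub' x).
  + by case: (hub' y).
- split.
    move=> [n23]; have ev : v = cst (vec 1 0) by rewrite -e3 -n23 e2.
    by move: v01; rewrite ev ltxx.
  move=> [w|]; split => //=.
  + by move=> /orP[/eqP->|/eqP->]; [left|right].
  + by move=> [[->]|[->]]; rewrite eqxx ?orbT.
  + by case.
- split.
  + by [].
  + move=> [n|]; first by apply: continuous_subspaceT; exact: (assembly_continuous aS (Se n)).
    by apply: continuous_subspaceT => t; exact: cvg_cst.
  + exists v1, v2; split.
    * by rewrite /= eqxx.
    * by rewrite /= e2 norm2 oner_neq0.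
    * by move=> t _; rewrite /p /= e2.
  + have unit_bar n t : (n == n2) || (n == n3) -> enorm (e n t) = 1.
      move=> /orP[/eqP->|/eqP->].
        by move: norm2; rewrite e2 /enorm dotpBC subr0.
      by rewrite e3 /enorm v_unit sqrtr1.
    move=> [m|] [n|] //= ij t _.
    * by apply/enorm_eqE; move: ij => /andP[_ /asboolP].
    * by rewrite !subr0 !unit_bar.
    * by rewrite /enorm !(dotpBC 0) !subr0 -!/(enorm _) !unit_bar.
  + exists 0, 1; split => // /(congr1 (fun f : vertex F -> 'rV[R]_2 => f v3 0 0)) /=.
    by rewrite e3 => h; move: v01; rewrite h ltxx.
- move=> s t s01 t01 st.
  by rewrite /= !subr0 e2 e3 !dotpE !mxE /= !mul1r !mul0r !addr0; exact: v_increasing.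
- move=> q [q0 qc _ qbar _] qv.
  have qbar' m n : rigid (e m) (e n) -> forall t, t \in `[0, 1] ->
      dotp (q t (Some m) - q t (Some n)) (q t (Some m) - q t (Some n)) =
      dotp (e m 0 - e n 0) (e m 0 - e n 0).
    have [->|mn] := eqVneq m n; first by move=> _ t _; rewrite !subrr.
    have q0' k : q 0 (Some k) = e k 0 := q0 (Some k).
    move=> r t t01; rewrite -!q0'; apply/enorm_eqE.
    by apply: qbar t01; rewrite /= mn; apply/asboolP.
  have clamp_in (t : R) : clamp t \in `[0, 1] by rewrite in_itv /= clamp01.
  have clamp0 : clamp 0 = 0 :> R by rewrite clamp_id // lexx ler01.
  pose q' (f : motion R) : motion R := fun t => q (clamp t) (Some (idx f)).
  have q'K f : S f -> q' f = f.
    apply: (assembly_determined aS).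
    - split.
      + by move=> g Sg; exact: (clamp_comp_continuous (qc (Some (idx g)))).
      + by move=> g Sg; rewrite /q' clamp0 q0 /= idxK.
      + move=> g h Sg Sh gh t.
        have r : rigid (e (idx g)) (e (idx h)) by rewrite !idxK.
        by rewrite /q' !(qbar' _ _ r) ?clamp_in.
    - move=> g [->|->]; apply/funext => t; have [_ h2 h3] := qv _ (clamp_in t).
      + by rewrite /q' h2 /= e2.
      + by rewrite /q' h3 /= e3 v_clamp.
  move=> t t01 [n|]; last by have [-> _ _] := qv t t01.
  have qn : q t (Some n) = q t (Some (idx (e n))).
    have r : rigid (e n) (e (idx (e n))) by rewrite idxK.
    have := qbar' _ _ r t t01; rewrite idxK // subrr.
    rewrite [in X in _ = X]dotpE !mxE mulr0 addr0 => d0.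
    apply/eqP; rewrite -subr_eq0; apply/negPn/negP => /dotp_gt0.
    by rewrite d0 ltxx.
  have := congr1 (fun f : motion R => f t) (q'K _ (Se n)).
  by rewrite /q' clamp_id -?qn // -in_itv.
- by [].
Qed.

End LinkageOfAssembly.

Section Crank.
Variable R : realType.

(** The abscissa is linear in the time, which makes the clamped time itself one of
the first functions to be realised; it stays at most [1 / 2], which keeps the arm
off the first axis. *)
Definition crank_arm : motion R :=
  fun t => vec (clamp t / 2) (Num.sqrt (1 - (clamp t / 2) ^+ 2)).

Lemma crank_arm_gap t : 0 < 1 - (clamp t / 2) ^+ 2 :> R.
Proof. by have /andP[? ?] := clamp01 t; rewrite expr2; nra. Qed.

Lemma crank_arm_continuous : continuous crank_arm.
Proof.
have ch : continuous (fun t : R => clamp t / 2).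
  by move=> t; apply: cvgM; [exact: clamp_continuous|exact: cvg_cst].
apply: vec_continuous; first exact: ch.
apply: (@sqrt_comp_continuous _ (fun t => 1 - (clamp t / 2) ^+ 2)) => t.
apply: cvgB; first exact: cvg_cst.
by apply: cvgM; exact: ch.
Qed.

Lemma crank_arm_unit t : dotp (crank_arm t) (crank_arm t) = 1.
Proof.
by rewrite dotpE !mxE /= -!expr2 sqr_sqrtr ?ltW ?crank_arm_gap // addrC subrK.
Qed.

Lemma crank_arm_offaxis t : crank_arm t 0 1 != 0.
Proof. by rewrite mxE /= gt_eqF // sqrtr_gt0 crank_arm_gap. Qed.

Lemma crank_arm_clamp t : crank_arm (clamp t) = crank_arm t.
Proof. by rewrite /crank_arm [clamp (clamp t)]clamp_id // clamp01. Qed.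

Lemma crank_arm_increasing :
  {in `[0, 1] &, {homo (fun t => crank_arm t 0 0) : s t / s < t}}.
Proof.
move=> s t; rewrite !in_itv /= => s01 t01 st.
by rewrite !mxE /= !clamp_id // ltr_pM2r // invr_gt0.
Qed.

Lemma axial_clamp : axial crank_arm (@clamp R).
Proof.
have arm : realisable (crank crank_arm) crank_arm.
  by apply: realisable_crank; [exact: crank_arm_continuous|right].
have := axialZ crank_arm_continuous crank_arm_unit crank_arm_offaxis 2
  (axial_coord0 crank_arm_continuous crank_arm_unit crank_arm_offaxis arm).
by under eq_fun do rewrite mxE /= mulrC divfK ?pnatr_eq0 //.
Qed.

End Crank.

Theorem theorem5p4 (R : realType) (gamma : R -> 'rV[R]_2)
  (gamma_continuous : {within `[0, 1], continuous gamma}) :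
  exists (F : framework R) (v1 v2 v3 : vertex F)
         (p : R -> vertex F -> 'rV[R]_2),
    infinite_linkage v1 v2 v3 p /\
    exists vm : vertex F, forall t : R, t \in `[0, 1] -> p t vm = gamma t.
Proof.
have curve := realisable_comp_clamp (@crank_arm_continuous R) (@crank_arm_unit R)
  (@crank_arm_offaxis R) (@axial_clamp R) gamma_continuous.
have [F [v1 [v2 [v3 [vm [p [link pm]]]]]]] := linkage_of_realisable
  (@crank_arm_unit R) (@crank_arm_clamp R) (@crank_arm_increasing R) curve.
exists F, v1, v2, v3, p; split => //; exists vm => t.
by rewrite pm in_itv /= => /clamp_id ->.
Qed.
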